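(* Let $\mathcal{A}$ be a unital $C^*$-algebra and let $D \in B^a(H_{\mathcal{A}})$. The following statements are equivalent: (1) $D \in \mathcal{M}\Phi_-(H_{\mathcal{A}})$, i.e. $D$ is a lower semi-$\mathcal{A}$-Fredholm operator; (2) there exist $F \in B^a(H_{\mathcal{A}})$ and $K \in K(H_{\mathcal{A}})$ such that $DF = I + K$.
   Context: $\mathcal{A}$ is a unital $C^*$-algebra; $H_{\mathcal{A}} = \ell^2(\mathcal{A})$ is the standard Hilbert $\mathcal{A}$-module of sequences $(a_i)$ in $\mathcal{A}$ with $\sum_i a_i^* a_i$ norm convergent. $B^a(H_{\mathcal{A}})$ is the $C^*$-algebra of bounded adjointable $\mathcal{A}$-linear operators on $H_{\mathcal{A}}$, and $K(H_{\mathcal{A}})$ is its closed two-sided ideal of compact operators (the norm closure of the linear span of the operators $z \mapsto x\langle y, z\rangle$). $M \tilde\oplus N$ denotes a direct sum of closed submodules that is not necessarily orthogonal. A Hilbert module is finitely generated if it is the (algebraic) $\mathcal{A}$-linear span of a finite set. An isomorphism of Hilbert modules is a bounded $\mathcal{A}$-linear bijection (with bounded inverse). $D \in B^a(H_{\mathcal{A}})$ is lower semi-$\mathcal{A}$-Fredholm, written $D \in \mathcal{M}\Phi_-(H_{\mathcal{A}})$, if there are closed submodules $M_1, N_1, M_2, N_2$ of $H_{\mathcal{A}}$ with $H_{\mathcal{A}} = M_1 \tilde\oplus N_1 = M_2 \tilde\oplus N_2$, with $D(M_1) \subseteq M_2$, $D(N_1) \subseteq N_2$, $D|_{M_1}: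 M_1 \to M_2$ an isomorphism, and $N_2$ finitely generated. *)

(* Defs.v *)
From HB Require Import structures.
From mathcomp Require Import all_boot all_order all_algebra.
From mathcomp Require Import all_classical all_reals all_analysis.
From mathcomp Require Import complex.

Set Implicit Arguments.
Unset Strict Implicit.
Unset Printing Implicit Defensive.

Import Order.TTheory GRing.Theory Num.Theory.
Import numFieldNormedType.Exports.

Local Open Scope classical_set_scope.
Local Open Scope ring_scope.
Local Open Scope complex_scope.

Reserved Notation "a ** b" (at level 40, left associativity).

(* The product is a field of the mixin, and not inherited from a ring
   structure, because Hierarchy-Builder has no join of normed modules and rings
   (numDomainType already inherits from both).  No axiom 1 != 0: the zero
   algebra is not excluded.  Norms take values in R[i], where _ <= _ compares
   complex numbers with equal imaginary parts. *)
HB.mixin Record isCStarAlgebra (R : realType) A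
    of CompleteNormedModule R[i] A := {
  cmul : A -> A -> A;
  cone : A;
  star : A -> A;
  cmulA : associative cmul;
  cmul1l : left_id cone cmul;
  cmul1r : right_id cone cmul;
  cmulDl : left_distributive cmul +%R;
  cmulDr : right_distributive cmul +%R;
  cmulZl : forall (c : R[i]) (a b : A), cmul (c *: a) b = c *: cmul a b;
  cmulZr : forall (c : R[i]) (a b : A), cmul a (c *: b) = c *: cmul a b;
  cnormM : forall a b : A, `|cmul a b| <= `|a| * `|b|;
  starD : forall a b : A, star (a + b) = star a + star b;
  starZ : forall (c : R[i]) (a : A), star (c *: a) = c^* *: star a;
  starM : forall a b : A, star (cmul a b) = cmul (star b) (star a);
  starK : involutive star;
  cstar_identity : forall a : A, `|cmul (star a) a| = `|a| ^+ 2
}.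

#[short(type="cstarAlgType")]
HB.structure Definition CStarAlgebra (R : realType) :=
  {A of CompleteNormedModule R[i] A & isCStarAlgebra R A}.

Notation "a ** b" := (cmul a b) : ring_scope.

Section StandardModule.
Context {R : realType} {A : cstarAlgType R}.

(* H_A is the subset l2 of the space of all sequences nat -> A.  Operators on
   H_A are total maps on nat -> A of which only the values on l2 matter. *)
Definition l2 : set (nat -> A) :=
  [set x | cvgn (series (fun i => star (x i) ** x i))].

(* limn is a default value on divergent sequences; the series converges as
   soon as x and y are in l2. *)
Definition inner (x y : nat -> A) : A :=
  limn (series (fun i => star (x i) ** y i)).

Definition l2norm (x : nat -> A) : R := Num.sqrt (complex.Re `|inner x x|).

Definition rscale (x : nat -> A) (a : A) : nat -> A := fun i => x i ** a.

Definition submodule (M : set (nat -> A)) : Prop :=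
  [/\ M `<=` l2, M 0,
      (forall x y, M x -> M y -> M (x + y)) &
      (forall x a, M x -> M (rscale x a))].

Definition closed_submodule (M : set (nat -> A)) : Prop :=
  submodule M /\
  forall x, l2 x ->
    (forall e : R, 0 < e -> exists2 y, M y & l2norm (x - y) < e) -> M x.

Definition l2_direct_sum (M N : set (nat -> A)) : Prop :=
  [/\ closed_submodule M, closed_submodule N,
      (forall x, l2 x -> exists m n, [/\ M m, N n & x = m + n]) &
      M `&` N = [set 0]].

Definition finitely_generated (N : set (nat -> A)) : Prop :=
  exists (n : nat) (g : 'I_n -> nat -> A),
    N = [set x | exists a : 'I_n -> A, x = \sum_(k < n) rscale (g k) (a k)].

Definition bounded_by (M : set (nat -> A)) (T : (nat -> A) -> nat -> A)
    (c : R) : Prop :=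
  forall x, M x -> l2norm (T x) <= c * l2norm x.

(* A-linearity implies R[i]-linearity because A is unital. *)
Definition bounded_linear (M N : set (nat -> A))
    (T : (nat -> A) -> nat -> A) : Prop :=
  [/\ (forall x, M x -> N (T x)),
      (forall x y, M x -> M y -> T (x + y) = T x + T y),
      (forall x a, M x -> T (rscale x a) = rscale (T x) a) &
      exists c : R, bounded_by M T c].

Definition module_iso (M N : set (nat -> A))
    (T : (nat -> A) -> nat -> A) : Prop :=
  bounded_linear M N T /\
  exists S, [/\ bounded_linear N M S,
                (forall x, M x -> S (T x) = x) &
                (forall y, N y -> T (S y) = y)].

Definition adjointable (T : (nat -> A) -> nat -> A) : Prop :=
  bounded_linear l2 l2 T /\
  exists S, (forall y, l2 y -> l2 (S y)) /\
            (forall x y, l2 x -> l2 y -> inner (T x) y = inner x (S y)).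

Definition rank_one (x y : nat -> A) : (nat -> A) -> nat -> A :=
  fun z => rscale x (inner y z).

(* K(H_A): operators of B^a(H_A) at operator norm distance 0 from the complex
   linear span of the rank_one x y with x and y in H_A. *)
Definition compact_operator (K : (nat -> A) -> nat -> A) : Prop :=
  adjointable K /\
  forall e : R, 0 < e ->
    exists (n : nat) (c : 'I_n -> R[i]) (x y : 'I_n -> nat -> A),
      (forall k, l2 (x k) /\ l2 (y k)) /\
      bounded_by l2 (fun z => K z - \sum_(k < n) c k *: rank_one (x k) (y k) z)
        e.

Definition lower_semi_fredholm (D : (nat -> A) -> nat -> A) : Prop :=
  adjointable D /\
  exists M1 N1 M2 N2 : set (nat -> A),
    [/\ l2_direct_sum M1 N1, l2_direct_sum M2 N2,
        (forall x, N1 x -> N2 (D x)),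
        module_iso M1 M2 D &
        finitely_generated N2].

End StandardModule.

Arguments l2 {R} A.

(* Main.v *)
Require Import Defs.
From mathcomp Require Import all_boot all_order all_algebra.
From mathcomp Require Import all_classical all_reals all_analysis.
From mathcomp Require Import complex.
From mathcomp Require Import ring lra.

Set Implicit Arguments.
Unset Strict Implicit.
Unset Printing Implicit Defensive.

Import Order.TTheory GRing.Theory Num.Theory.
Import numFieldNormedType.Exports.

Local Open Scope classical_set_scope.
Local Open Scope ring_scope.
Local Open Scope complex_scope.

(** Suppose first that H = M1 + N1 = M2 + N2 reduces D, with N2 generated by
g_1, ..., g_n.  The obvious candidate for F, the inverse of D on M2 composed
with the projection onto M2 along N2, is in general not adjointable.  But D(M1)
is M2, so every vector has the form T (x, a) = D x + sum_k g_k a_k, and T is an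
adjointable surjection from the direct sum of H and A^n.  Therefore
S = T T^* = D D^* + sum_k g_k <g_k, .> is invertible with self-adjoint inverse V,
and F = D^* V satisfies D F = 1 - sum_k g_k <V g_k, .>, so that D F - 1 has
finite rank ([regularizer_of_spanning]).  The invertibility of S has two
ingredients.  T^* is bounded below by a gliding-hump argument
([bounded_below]); and norm estimates that are stable under right
multiplication by A hold as inequalities between positive elements of A
([pos_le_of_nrm]), which turn 1 - t S into a contraction for small t
([self_adjoint_inverse]).

Conversely let D F = 1 + K.  For large n the projection Q onto the coordinates
from n on satisfies |Q K| <= 1/2, and V = (1 + Q K)^-1 exists.  Then G = F V Q is
a generalized inverse of D, that is, G D G = G, and the kernel of D G is the
kernel of Q, a free module on n generators.  The idempotents G D and D G provide
the two decompositions ([generalized_inverse_fredholm]).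

Underneath lie two elementary theories.  In A, the positive cone is built from
square roots obtained by iteration; this leads to the positivity of star x ** x
([pos_starl]) and the monotonicity of the norm ([pos_le_nrm]).  On l2, the
Cauchy-Schwarz inequality on finite ranges of indices gives the inner product,
the norm and completeness ([wip_le], [l2_complete]). *)

(** * Real-valued norm and convergence in a C*-algebra *)

Section CStarBasics.
Context {R : realType} {A : cstarAlgType R}.
Implicit Types (a b c d p q x y z : A) (s t e : R).

Definition nrm a : R := complex.Re `|a|.

Lemma nrmE a : `|a| = (nrm a)%:C.
Proof. by rewrite /nrm RRe_real // normr_real. Qed.

Lemma nrm_ge0 a : 0 <= nrm a.
Proof. by rewrite -ler0c -nrmE. Qed.

Lemma nrm0 : nrm 0 = 0.
Proof. by rewrite /nrm normr0. Qed.

Lemma nrm_eq0 a : nrm a = 0 -> a = 0.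
Proof. by move=> a0; apply/normr0_eq0; rewrite nrmE a0. Qed.

Lemma nrmN a : nrm (- a) = nrm a.
Proof. by rewrite /nrm normrN. Qed.

Lemma nrmBC a b : nrm (a - b) = nrm (b - a).
Proof. by rewrite /nrm distrC. Qed.

Lemma ler_nrmD a b : nrm (a + b) <= nrm a + nrm b.
Proof. by rewrite -lecR rmorphD /= -!nrmE ler_normD. Qed.

Lemma ler_nrm_sum (I : Type) (r : seq I) (f : I -> A) :
  nrm (\sum_(i <- r) f i) <= \sum_(i <- r) nrm (f i).
Proof.
elim: r => [|i r IH]; first by rewrite !big_nil nrm0.
by rewrite !big_cons (le_trans (ler_nrmD _ _)) // lerD.
Qed.

Lemma ler_nrmB a b : nrm (a - b) <= nrm a + nrm b.
Proof. by rewrite -(nrmN b) ler_nrmD. Qed.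

Lemma nrmZ (k : R[i]) a : nrm (k *: a) = complex.Re `|k| * nrm a.
Proof.
apply: complexI; rewrite rmorphM /= -nrmE normrZ nrmE.
by rewrite RRe_real // normr_real.
Qed.

Lemma nrmZr t a : nrm (t%:C *: a) = `|t| * nrm a.
Proof. by rewrite nrmZ normc_def /= expr0n addr0 sqrtr_sqr. Qed.

Lemma nrm_double a : nrm (a + a) = nrm a + nrm a.
Proof.
rewrite -[X in X + X]scale1r -scalerDl -(rmorph1 (real_complex R)) -rmorphD /=.
by rewrite nrmZr ger0_norm //; lra.
Qed.

Lemma nrmM a b : nrm (a ** b) <= nrm a * nrm b.
Proof. by rewrite -lecR rmorphM /= -!nrmE cnormM. Qed.

Lemma nrm_starl a : nrm (star a ** a) = nrm a ^+ 2.
Proof. by apply: complexI; rewrite rmorphXn /= -!nrmE cstar_identity. Qed.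

Lemma nrm_star a : nrm (star a) = nrm a.
Proof.
have le b : nrm b <= nrm (star b).
  have := nrmM (star b) b; rewrite nrm_starl expr2.
  have [->|b0] := eqVneq (nrm b) 0; first by rewrite nrm_ge0.
  by rewrite ler_pM2r // lt_def b0 nrm_ge0.
by apply/eqP; rewrite eq_le le -{2}(starK a) le.
Qed.

Lemma cmulNl a b : (- a) ** b = - (a ** b).
Proof. by rewrite -scaleN1r cmulZl scaleN1r. Qed.
Lemma cmulNr a b : a ** (- b) = - (a ** b).
Proof. by rewrite -scaleN1r cmulZr scaleN1r. Qed.
Lemma cmulBl a b c : (a - b) ** c = a ** c - b ** c.
Proof. by rewrite cmulDl cmulNl. Qed.
Lemma cmulBr a b c : a ** (b - c) = a ** b - a ** c.
Proof. by rewrite cmulDr cmulNr. Qed.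
Lemma cmul0l a : 0 ** a = 0.
Proof. by rewrite -(scale0r (0 : A)) cmulZl !scale0r. Qed.
Lemma cmul0r a : a ** 0 = 0.
Proof. by rewrite -(scale0r (0 : A)) cmulZr !scale0r. Qed.
Lemma starN a : star (- a) = - star a.
Proof. by rewrite -scaleN1r starZ rmorphN1 scaleN1r. Qed.
Lemma starB a b : star (a - b) = star a - star b.
Proof. by rewrite starD starN. Qed.
Lemma star0 : star (0 : A) = 0.
Proof. by rewrite -(scale0r (0 : A)) starZ rmorph0 !scale0r. Qed.
Lemma starZr t a : star (t%:C *: a) = t%:C *: star a.
Proof. by rewrite starZ conj_Creal // complex_real. Qed.
Lemma star1 : star (cone : A) = cone.
Proof. by rewrite -[LHS]cmul1r -[X in _ ** X](starK cone) -starM cmul1r starK. Qed.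

Lemma cmul_suml (I : Type) (r : seq I) (P : pred I) (f : I -> A) a :
  (\sum_(i <- r | P i) f i) ** a = \sum_(i <- r | P i) f i ** a.
Proof. exact: (big_morph (fun x => x ** a) (fun x y => cmulDl x y a) (cmul0l a)). Qed.
Lemma star_sum (I : Type) (r : seq I) (P : pred I) (f : I -> A) :
  star (\sum_(i <- r | P i) f i) = \sum_(i <- r | P i) star (f i).
Proof. exact: (big_morph _ starD star0). Qed.

Definition sc t : A := t%:C *: cone.

Lemma cmul_scl t a : sc t ** a = t%:C *: a.
Proof. by rewrite cmulZl cmul1l. Qed.
Lemma cmul_scr t a : a ** sc t = t%:C *: a.
Proof. by rewrite cmulZr cmul1r. Qed.
Lemma scD s t : sc (s + t) = sc s + sc t.
Proof. by rewrite /sc rmorphD scalerDl. Qed.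
Lemma scB s t : sc (s - t) = sc s - sc t.
Proof. by rewrite /sc rmorphB scalerBl. Qed.
Lemma star_sc t : star (sc t) = sc t.
Proof. by rewrite starZr star1. Qed.

Lemma nrm1_le1 : nrm (cone : A) <= 1.
Proof.
have := nrm_starl (cone : A); rewrite star1 cmul1l => /eqP.
rewrite expr2 -subr_eq0 -{1}[nrm _]mulr1 -mulrBr mulf_eq0.
by case/orP => [/eqP->|]; rewrite // subr_eq0 => /eqP <-.
Qed.

Lemma nrm_sc t : 0 <= t -> nrm (sc t) <= t.
Proof.
by move=> t0; rewrite nrmZr ger0_norm // -{2}[t]mulr1 ler_wpM2l // nrm1_le1.
Qed.

(** The real majorant nrm (u n - l) lets the squeeze theorem for real sequences
prove limits in A; [tendsE] identifies this with the convergence of the normed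
module A. *)
Definition tends (u : nat -> A) (l : A) : Prop :=
  (fun n => nrm (u n - l)) @ \oo --> (0 : R).

Lemma tendsE u l : tends u l <-> u @ \oo --> l.
Proof.
split=> ul.
  apply/cvgrPdist_lt => -[e ei] e0.
  have [ei0 er0] : ei = 0 /\ 0 < e.
    by move: e0; rewrite ltcE /= => /andP[/eqP-> ->].
  rewrite {e0}ei0; move/cvgr0Pnorm_lt : ul => /(_ e er0).
  apply: filterS => n; rewrite ger0_norm ?nrm_ge0 // => h.
  by rewrite distrC nrmE ltcR.
apply/cvgr0Pnorm_lt => e e0; move/cvgrPdist_lt : ul => /(_ e%:C).
rewrite ltcR => /(_ e0); apply: filterS => n.
by rewrite distrC nrmE ltcR ger0_norm ?nrm_ge0.
Qed.

Lemma tends_squeeze (u : nat -> A) l (f : nat -> R) :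
  f @ \oo --> (0 : R) -> (forall n, nrm (u n - l) <= f n) -> tends u l.
Proof.
move=> f0 le; apply: (@squeeze_cvgr _ _ _ _ (cst 0) f) => //.
- by near=> n; rewrite nrm_ge0 le.
- exact: cvg_cst.
Unshelve. all: by end_near. Qed.

Lemma tends_cst a : tends (fun=> a) a.
Proof.
by apply: (@tends_squeeze _ _ (cst 0)) => [|n]; [exact: cvg_cst | rewrite subrr nrm0].
Qed.

Lemma tendsD u v a b : tends u a -> tends v b -> tends (fun n => u n + v n) (a + b).
Proof.
move=> ua vb; apply: (@tends_squeeze _ _ (fun n => nrm (u n - a) + nrm (v n - b))).
  by rewrite -[0]addr0; apply: cvgD.
by move=> n; rewrite opprD addrACA ler_nrmD.
Qed.

Lemma tendsM u v a b : tends u a -> tends v b -> tends (fun n => u n ** v n) (a ** b).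
Proof.
move=> ua vb.
apply: (@tends_squeeze _ _ (fun n => nrm (u n - a) * (nrm (v n - b) + nrm b)
                              + nrm a * nrm (v n - b))).
  have -> : (0 : R) = 0 * (0 + nrm b) + nrm a * 0 by ring.
  by apply: cvgD; apply: cvgM => //; [apply: cvgD => //|]; exact: cvg_cst.
move=> n.
have -> : u n ** v n - a ** b = (u n - a) ** v n + a ** (v n - b).
  by rewrite cmulBl cmulBr addrA subrK.
apply: le_trans (ler_nrmD _ _) _; apply: lerD; last exact: nrmM.
apply: le_trans (nrmM _ _) _; apply: ler_wpM2l; first exact: nrm_ge0.
by rewrite -{1}[v n](subrK b) ler_nrmD.
Qed.

Lemma tends_star u a : tends u a -> tends (fun n => star (u n)) (star a).
Proof.
by move=> ua; apply: tends_squeeze ua _ => n; rewrite -starB nrm_star.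
Qed.

Lemma tends_unique u a b : tends u a -> tends u b -> a = b.
Proof. by move=> /tendsE ua /tendsE ub; apply: cvg_unique ua ub. Qed.

Lemma tends_ext u v a : (forall n, u n = v n) -> tends u a -> tends v a.
Proof. by move=> /funext ->. Qed.

Lemma tends_shift u a k : tends u a -> tends (fun n => u (n + k)%N) a.
Proof. by rewrite /tends (cvg_shiftn k (fun n => nrm (u n - a))). Qed.

Lemma tends_nrm u a : tends u a -> (fun n => nrm (u n)) @ \oo --> nrm a.
Proof.
move=> ua; apply/cvgrPdist_le => e e0.
move/cvgr0Pnorm_le : ua => /(_ e e0); apply: filterS => n.
rewrite ger0_norm ?nrm_ge0 // => h; apply: le_trans h.
have := ler_nrmD (u n - a) a; have := ler_nrmD (a - u n) (u n).
by rewrite !subrK (nrmBC a) ler_norml => ? ?; apply/andP; split; lra.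
Qed.

Lemma tends_le u a t : tends u a -> (\forall n \near \oo, nrm (u n) <= t) -> nrm a <= t.
Proof.
move=> /tends_nrm ua ut.
have <- : lim ((fun n => nrm (u n)) @ \oo) = nrm a by apply: cvg_lim.
by apply: limr_le => //; exact: cvgP ua.
Qed.

Lemma tendsP u a : tends u a <->
  forall e, 0 < e -> exists N, forall n, (N <= n)%N -> nrm (u n - a) <= e.
Proof.
split=> [/cvgr0Pnorm_le h e e0|h].
  have [N _ hN] := h e e0; exists N => n Nn.
  by have := hN n Nn; rewrite /= ger0_norm ?nrm_ge0.
apply/cvgr0Pnorm_le => e e0; have [N hN] := h e e0; exists N => // n Nn /=.
by rewrite ger0_norm ?nrm_ge0 // hN.
Qed.

Lemma cauchy_tends (u : nat -> A) :
  (forall e, 0 < e -> exists N, forall n, (N <= n)%N -> nrm (u n - u N) <= e) ->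
  exists l, tends u l.
Proof.
move=> uC; suff /cvg_ex[l /tendsE ul] : cvgn u by exists l.
apply/cauchy_cvgP/cauchy_exP => -[e ei] e0.
have [ei0 er0] : ei = 0 /\ 0 < e.
  by move: e0; rewrite ltcE /= => /andP[/eqP-> ->].
rewrite {e0}ei0; have [N hN] := uC (e / 2) (divr_gt0 er0 (ltr0n _ 2)).
exists (u N); exists N => // n Nn /=; rewrite -ball_normE /=.
rewrite distrC nrmE ltcR; apply: le_lt_trans (hN n Nn) _.
by rewrite ltr_pdivrMr // mulr_natr mulr2n ltrDl.
Qed.

(** Completeness in the form used throughout: a sequence whose steps are bounded
by the steps of a convergent real sequence converges, and the real sequence
also bounds the distance to the limit. *)
Lemma majorant_tends (u : nat -> A) (f : nat -> R) (E : R) :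
  f @ \oo --> E -> (forall n, nrm (u n.+1 - u n) <= f n.+1 - f n) ->
  exists l, tends u l /\ forall n, nrm (l - u n) <= E - f n.
Proof.
move=> fE le.
have leD n k : nrm (u (n + k)%N - u n) <= f (n + k)%N - f n.
  elim: k => [|k IH]; first by rewrite addn0 !subrr nrm0.
  rewrite addnS -(subrK (u (n + k)%N) (u _.+1)) -addrA.
  apply: le_trans (ler_nrmD _ _) _.
  by rewrite -(subrK (f (n + k)%N) (f _.+1)) -[leRHS]addrA lerD.
have fnd : nondecreasing_seq f.
  apply/nondecreasing_seqP => n; rewrite -subr_ge0.
  exact: le_trans (nrm_ge0 _) (le n).
have fleE n : f n <= E.
  by rewrite -(cvg_lim _ fE) //; apply: nondecreasing_cvgn_le => //; exact: cvgP fE.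
have [l ul] : exists l, tends u l.
  apply: cauchy_tends => e e0.
  move/cvgrPdist_le : fE => /(_ e e0) [N _ hN]; exists N => n Nn.
  rewrite -(subnKC Nn); apply: le_trans (leD _ _) _.
  have := hN N (leqnn N); rewrite /= ger0_norm ?subr_ge0 //.
  by apply: le_trans; rewrite lerB.
exists l; split=> // n; rewrite nrmBC.
rewrite nrmBC; apply: (@tends_le (fun k => u (k + n)%N - u n)).
  by apply: tendsD; [exact: tends_shift | exact: tends_cst].
by near=> k; rewrite addnC; apply: le_trans (leD _ _) _; rewrite lerB.
Unshelve. all: by end_near. Qed.

End CStarBasics.

(** * The positive cone *)

Section Positivity.
Context {R : realType} {A : cstarAlgType R}.
Implicit Types (a b c d p q x y z : A) (s t e : R).

(** The iteration v |-> (w + v^2) / 2 converges to 1 - sqrt (1 - w).  Nothing but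
products and limits enters it, so the limit inherits from w self-adjointness
and commutation relations. *)
Fixpoint sqrt_iter (w : A) (n : nat) : A :=
  if n is m.+1 then (2^-1)%:C *: (w + sqrt_iter w m ** sqrt_iter w m) else 0.

(** The same iteration in R, at w = 1.  It increases to 1, also in this critical
case, and dominates the iteration in A. *)
Fixpoint sqrt_major (n : nat) : R :=
  if n is m.+1 then (1 + sqrt_major m ^+ 2) / 2 else 0.

Lemma sqrt_major_le1 n : 0 <= sqrt_major n <= 1.
Proof. elim: n => [|n] /=; first by lra. by nra. Qed.

Lemma sqrt_major_cvg : exists2 E : R, E <= 1 & sqrt_major @ \oo --> E.
Proof.
have cv : cvgn sqrt_major.
  apply: nondecreasing_is_cvgn.
    apply/nondecreasing_seqP => n /=; have := sqrt_major_le1 n.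
    by have := sqr_ge0 (1 - sqrt_major n); lra.
  by exists 1 => _ [n _ <-]; case/andP: (sqrt_major_le1 n).
exists (limn sqrt_major) => //; apply: limr_le => //.
by near=> n; case/andP: (sqrt_major_le1 n).
Unshelve. all: by end_near. Qed.

Lemma sqrt_iter_le w n : nrm w <= 1 -> nrm (sqrt_iter w n) <= sqrt_major n.
Proof.
move=> w1; elim: n => [|n IH] /=; first by rewrite nrm0.
rewrite nrmZr ger0_norm ?invr_ge0 // mulrC ler_wpM2r ?invr_ge0 //.
apply: le_trans (ler_nrmD _ _) _; apply: lerD => //.
apply: le_trans (nrmM _ _) _; rewrite expr2.
by apply: ler_pM; rewrite ?nrm_ge0.
Qed.

Lemma sqrt_iter_step w n : nrm w <= 1 ->
  nrm (sqrt_iter w n.+1 - sqrt_iter w n) <= sqrt_major n.+1 - sqrt_major n.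
Proof.
move=> w1; elim: n => [|n IH].
  rewrite /= cmul0l addr0 !subr0 expr0n addr0 nrmZr ger0_norm ?invr_ge0 //.
  by rewrite mulrC ler_wpM2r ?invr_ge0.
have eu : sqrt_iter w n.+2 =
    (2^-1)%:C *: (w + sqrt_iter w n.+1 ** sqrt_iter w n.+1) by [].
have ev : sqrt_iter w n.+1 = (2^-1)%:C *: (w + sqrt_iter w n ** sqrt_iter w n) by [].
have es : sqrt_major n.+2 = (1 + sqrt_major n.+1 ^+ 2) / 2 by [].
have et : sqrt_major n.+1 = (1 + sqrt_major n ^+ 2) / 2 by [].
rewrite eu [X in _ - X]ev es [X in _ <= _ - X]et.
have lu := sqrt_iter_le n.+1 w1; have lv := sqrt_iter_le n w1.
move: (sqrt_major_le1 n.+1) (sqrt_major_le1 n) IH lu lv; clear.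
move: (sqrt_iter w n.+1) (sqrt_iter w n) (sqrt_major n.+1) (sqrt_major n) => u v s t.
move=> /andP[s0 _] /andP[t0 _] h hu hv.
rewrite -scalerBr opprD addrACA subrr add0r nrmZr ger0_norm ?invr_ge0 //.
(* This form of the difference of squares is valid without commutation. *)
have -> : u ** u - v ** v = u ** (u - v) + (u - v) ** v.
  by rewrite cmulBl cmulBr addrA subrK.
have : nrm (u ** (u - v) + (u - v) ** v) <= s * (s - t) + (s - t) * t.
  apply: le_trans (ler_nrmD _ _) _.
  by apply: lerD; apply: le_trans (nrmM _ _) _; apply: ler_pM; rewrite ?nrm_ge0.
move=> h'; have -> : (1 + s ^+ 2) / 2 - (1 + t ^+ 2) / 2 =
    2^-1 * (s * (s - t) + (s - t) * t) by field.
by rewrite ler_wpM2l // invr_ge0.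
Qed.

Lemma one_sub_sqrt w : star w = w -> nrm w <= 1 ->
  exists v, [/\ star v = v, nrm v <= 1, v + v = w + v ** v &
                forall c, c ** w = w ** c -> c ** v = v ** c].
Proof.
move=> sw w1; have [E E1 cE] := sqrt_major_cvg.
have [v [tv hv]] := majorant_tends cE (fun n => sqrt_iter_step n w1).
exists v; split.
- apply: (tends_unique _ tv); apply: tends_ext (tends_star tv); elim=> [|n IH] /=.
    exact: star0.
  by rewrite starZr starD sw starM IH.
- by have := hv 0; rewrite /= !subr0 => h; apply: le_trans h E1.
- have tv1 := tends_shift 1 tv.
  apply: tends_unique (tendsD tv1 tv1) _.
  apply: tends_ext (tendsD (tends_cst w) (tendsM tv tv)) => n.
  rewrite addn1 /= -scalerDl -rmorphD /=.
  by have -> : 2^-1 + 2^-1 = 1 :> R; [by field | rewrite scale1r].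
- move=> c cw; apply: tends_unique (tendsM (tends_cst c) tv) _.
  apply: tends_ext (tendsM tv (tends_cst c)).
  elim=> [|n IH] /=; first by rewrite cmul0r cmul0l.
  rewrite cmulZr cmulZl; congr (_ *: _).
  by rewrite cmulDr cmulDl cw cmulA -IH -!cmulA IH.
Qed.

(** Positivity in the sense of Kelley and Vaught: the spectrum of a lies in
[0, 2t].  Closure under sums is immediate from this form, whereas positivity
of star x ** x is a theorem ([pos_starl]). *)
Definition pos a : Prop := star a = a /\ exists2 t, 0 < t & nrm (sc t - a) <= t.

(** With w = 1 - a / t, of norm at most 1, the root is sqrt t times (1 - v),
where (1 - v)^2 = 1 - w = a / t. *)
Lemma pos_sqrt a : pos a ->
  exists c, [/\ pos c, c ** c = a & forall x, x ** a = a ** x -> x ** c = c ** x].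
Proof.
move=> [sa [t t0 at_]]; pose w : A := cone - t^-1%:C *: a.
have w1 : nrm w <= 1.
  have -> : w = t^-1%:C *: (sc t - a).
    rewrite scalerBr /sc scalerA -rmorphM mulVf ?gt_eqF //.
    by rewrite rmorph1 scale1r.
  by rewrite nrmZr gtr0_norm ?invr_gt0 // mulrC ler_pdivrMr // mul1r.
have sw : star w = w by rewrite starB star1 starZr sa.
have [v [sv v1 ev cv]] := one_sub_sqrt sw w1.
exists ((Num.sqrt t)%:C *: (cone - v)); split.
- split; first by rewrite starZr starB star1 sv.
  exists (Num.sqrt t); first by rewrite sqrtr_gt0.
  rewrite scalerBr opprB addrC subrK nrmZr ger0_norm ?sqrtr_ge0 //.
  by rewrite ler_piMr ?sqrtr_ge0.
- rewrite cmulZl cmulZr scalerA -rmorphM -expr2 sqr_sqrtr ?ltW //.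
  have -> : (cone - v) ** (cone - v) = cone - w.
    rewrite cmulBl cmul1l cmulBr cmul1r -addrA -opprD; congr (_ - _).
    by rewrite addrA ev addrK.
  by rewrite subKr scalerA -rmorphM mulfV ?gt_eqF // rmorph1 scale1r.
- move=> x xa; rewrite cmulZr cmulZl; congr (_ *: _).
  rewrite cmulBr cmulBl cmul1l cmul1r; congr (_ - _); apply: cv.
  by rewrite cmulBr cmulBl cmul1l cmul1r cmulZl cmulZr xa.
Qed.

Lemma posD a b : pos a -> pos b -> pos (a + b).
Proof.
move=> [sa [t t0 ta]] [sb [u u0 ub]]; split; first by rewrite starD sa sb.
exists (t + u); first by rewrite addr_gt0.
by rewrite scD opprD addrACA (le_trans (ler_nrmD _ _)) // lerD.
Qed.

Lemma pos0 : pos 0.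
Proof.
by split; [exact: star0 | exists 1; rewrite // subr0 nrm_sc].
Qed.

Lemma pos_sum (I : Type) (r : seq I) (P : pred I) (f : I -> A) :
  (forall i, P i -> pos (f i)) -> pos (\sum_(i <- r | P i) f i).
Proof. by move=> h; elim/big_ind: _ => //; [exact: pos0 | exact: posD]. Qed.

Lemma posZ t a : 0 <= t -> pos a -> pos (t%:C *: a).
Proof.
rewrite le_eqVlt => /predU1P[<- _|t0 [sa [u u0 ua]]].
  by rewrite scale0r; exact: pos0.
split; first by rewrite starZr sa.
exists (t * u); first by rewrite mulr_gt0.
by rewrite /sc rmorphM -scalerA -scalerBr nrmZr gtr0_norm // ler_pM2l.
Qed.

(** t - a is at distance |a| from t, so t is a radius for it; the proof takes t + 1
because the radius must not vanish. *)
Lemma pos_scB a t : star a = a -> nrm a <= t -> pos (sc t - a).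
Proof.
move=> sa at_; split; first by rewrite starB star_sc sa.
have t0 : 0 <= t by apply: le_trans at_; exact: nrm_ge0.
exists (t + 1); first by lra.
rewrite opprB addrCA -scB [t + 1]addrC addrK.
by apply: le_trans (ler_nrmD _ _) _; rewrite addrC lerD // nrm_sc.
Qed.

(** The element w = c + i d satisfies w^* w = t, because c and d commute; hence
the norm of w is at most sqrt t, and so is that of c, the half of w + w^*.  This is
the only source of sharp norm estimates for positive elements. *)
Lemma sum_sqr_bound c d t : 0 <= t -> star c = c -> star d = d -> c ** d = d ** c ->
  c ** c + d ** d = sc t -> nrm (c ** c) <= t.
Proof.
move=> t0 sc_ sd cd e; pose w := c + 'i%R *: d.
have sw : star w = c - 'i%R *: d by rewrite starD starZ sc_ sd conjCi scaleNr.
have ww : star w ** w = sc t.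
  rewrite sw cmulBl !cmulDr !cmulZl !cmulZr -e cd scalerA -expr2 sqrCi scaleN1r.
  by rewrite opprD opprK addrA addrK.
have nw : nrm w ^+ 2 <= t by rewrite -nrm_starl ww nrm_sc.
have c2 : c + c = w + star w by rewrite sw addrACA subrr addr0.
have nc : nrm c <= nrm w.
  have : nrm (c + c) <= nrm w + nrm w.
    by rewrite c2 (le_trans (ler_nrmD _ _)) // nrm_star.
  by rewrite nrm_double; lra.
apply: le_trans (nrmM _ _) _; apply: le_trans nw; rewrite expr2.
by apply: ler_pM; rewrite ?nrm_ge0.
Qed.

(** Since t - c^2 with t = |c|^2 is positive, it has a root d, and [sum_sqr_bound]
applied to d and c bounds the norm of t - c^2 = d^2 by t. *)
Lemma pos_sqr c : star c = c -> pos (c ** c).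
Proof.
move=> sc_; pose t := nrm c ^+ 2.
have cc : nrm (c ** c) <= t by rewrite -{1}sc_ nrm_starl.
have scc : star (c ** c) = c ** c by rewrite starM sc_.
have [d [[sd _] dd cd]] := pos_sqrt (pos_scB scc cc).
split=> //; exists (t + 1); first by have := sqr_ge0 (nrm c); rewrite -/t; lra.
rewrite [t + 1]addrC scD -addrA; apply: le_trans (ler_nrmD _ _) _.
rewrite lerD ?nrm_sc // -dd; apply: (@sum_sqr_bound d c) => //.
- exact: sqr_ge0.
- by apply/esym/cd; rewrite cmulBr cmulBl cmul_scl cmul_scr cmulA.
- by rewrite dd subrK.
Qed.

(** The roots of a and of t - a commute, and their squares sum to t. *)
Lemma pos_nrm_le a t : 0 <= t -> pos a -> pos (sc t - a) -> nrm a <= t.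
Proof.
move=> t0 /pos_sqrt[c [[sc_ _] <- cc]] /pos_sqrt[d [[sd _] dd cd]].
apply: (@sum_sqr_bound c d) => //; last by rewrite dd subrKC.
by apply: cd; rewrite cmulBr cmulBl cmul_scl cmul_scr cmulA.
Qed.

Lemma pos_le_nrm a b : pos a -> pos (b - a) -> nrm a <= nrm b.
Proof.
move=> pa pba; apply: pos_nrm_le => //; first exact: nrm_ge0.
have -> : sc (nrm b) - a = sc (nrm b) - b + (b - a) by rewrite addrA subrK.
apply: posD => //; apply: pos_scB => //.
by rewrite -(subrK a b) starD; case: pba => -> _; case: pa => ->.
Qed.

Lemma pos_anti a : pos a -> pos (- a) -> a = 0.
Proof.
move=> pa pNa; apply: nrm_eq0; apply/eqP; rewrite eq_le nrm_ge0 andbT.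
by rewrite -(@nrm0 _ A); apply: pos_le_nrm => //; rewrite sub0r.
Qed.

Lemma sqr_nilp a : star a = a -> a ** a = 0 -> a = 0.
Proof.
move=> sa a0; apply: nrm_eq0; apply/eqP; rewrite -sqrf_eq0 -nrm_starl sa a0.
by rewrite nrm0.
Qed.

(** The two roots are, up to sign, twice the real and imaginary parts of x. *)
Lemma starl_add_starr_eq_sqr x : exists a b, [/\ star a = a, star b = b &
  a ** a + b ** b = star x ** x + x ** star x + (star x ** x + x ** star x)].
Proof.
exists (x + star x), ('i%R *: (x - star x)); split.
- by rewrite starD starK addrC.
- by rewrite starZ starB starK conjCi scaleNr -scalerN opprB.
- rewrite cmulZl cmulZr scalerA -expr2 sqrCi scaleN1r.
  rewrite cmulBl !cmulBr cmulDl !cmulDr.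
  move: (x ** x) (x ** star x) (star x ** x) (star x ** star x) => p q r s.
  rewrite opprB (opprB p) (addrC (r - s)) addrACA (addrC p).
  by rewrite (addrACA q p q) (addrACA r s r) !subrr !addr0 addrC addrACA.
Qed.

(** Suppose star y ** y = - p and put p = r^2, z = y r.  Then z^* z = - p^2 and
z z^* = - q^2 with q = y y^*, so that z^* z + z z^* is at once negative and, by
[starl_add_starr_eq_sqr], positive; so it vanishes, and p^2 = 0. *)
Lemma starl_neg y p : pos p -> star y ** y = - p -> y = 0.
Proof.
move=> pp yp; have [r [[sr _] rr _]] := pos_sqrt pp.
have sp : star p = p by case: pp.
have ple : pos (- (p ** p + (y ** star y) ** (y ** star y))).
  have [u [v [su sv uv]]] := starl_add_starr_eq_sqr (y ** r).
  have e1 : star (y ** r) ** (y ** r) = - (p ** p).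
    by rewrite starM sr -cmulA (cmulA (star y)) yp cmulNl cmulNr -rr !cmulA.
  have e2 : (y ** r) ** star (y ** r) = - ((y ** star y) ** (y ** star y)).
    rewrite starM sr !cmulA -(cmulA y r) rr -(opprK p) -yp.
    by rewrite cmulNr cmulNl !cmulA.
  rewrite opprD -e1 -e2.
  rewrite -[X in pos X]scale1r -(rmorph1 (real_complex R)).
  have <- : 2^-1 * 2 = 1 :> R by field.
  rewrite rmorphM -scalerA; apply: posZ; rewrite ?invr_ge0 //.
  rewrite /= [(2 : R)]mulr2n rmorphD /= scalerDl rmorph1 scale1r -uv.
  by apply: posD; exact: pos_sqr.
have syy : star (y ** star y) = y ** star y by rewrite starM starK.
have p0 : p ** p = 0.
  apply: pos_anti; first exact: pos_sqr.
  have -> : - (p ** p) = - (p ** p + (y ** star y) ** (y ** star y)) +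
      (y ** star y) ** (y ** star y) by rewrite opprD subrK.
  by apply: posD => //; exact: pos_sqr.
apply: nrm_eq0; apply/eqP; rewrite -sqrf_eq0 -nrm_starl yp (sqr_nilp sp p0).
by rewrite oppr0 nrm0.
Qed.

(** Let a = x^* x, b = |a| and n = b - a, that is, twice the negative part of a.
Then n a n = - n b n is negative, but it is also (x n)^* (x n), so x n = 0 by
[starl_neg]; this forces n = 0, and a = b is positive. *)
Lemma pos_starl x : pos (star x ** x).
Proof.
set a := star x ** x; have sa : star a = a by rewrite starM starK.
have [b [pb bb cb]] := pos_sqrt (pos_sqr sa).
have ab : a ** b = b ** a by apply: cb; rewrite cmulA.
have [sb _] := pb.
have [d [[sd _] dd cd]] := pos_sqrt pb.
pose n := b - a; have sn : star n = n by rewrite starB sa sb.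
(* b^2 = a^2 and a, b commute. *)
have nba : n ** (b + a) = 0.
  by rewrite cmulBl !cmulDr bb ab opprD addrA addrK subrr.
have nan : n ** a ** n = - (n ** b ** n).
  apply/eqP; rewrite -addr_eq0 -cmulDl addrC -cmulDr.
  by rewrite nba cmul0l.
have nd : n ** d = d ** n by apply: cd; rewrite cmulBl cmulBr ab.
have pn : pos (n ** b ** n).
  have -> : n ** b ** n = (n ** d) ** (n ** d) by rewrite {2}nd -dd !cmulA.
  by apply: pos_sqr; rewrite starM sn sd nd.
have y0 : x ** n = 0.
  by apply: starl_neg pn _; rewrite starM sn -nan !cmulA -(cmulA n).
have nan0 : n ** a ** n = 0 by rewrite /a -!cmulA y0 !cmul0r.
have nnn : n ** n ** n = 0.
  rewrite {2}/n cmulBr cmulBl nan0 subr0.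
  by apply/eqP; rewrite -oppr_eq0 -nan nan0.
have n0 : n = 0.
  apply: sqr_nilp => //; apply: sqr_nilp; first by rewrite starM sn.
  by rewrite cmulA nnn cmul0l.
by move/eqP: n0; rewrite subr_eq0 => /eqP <-.
Qed.

Lemma pos_conj p c : pos p -> pos (star c ** p ** c).
Proof.
move=> /pos_sqrt[s [[ss _] <- _]].
have -> : star c ** (s ** s) ** c = star (s ** c) ** (s ** c).
  by rewrite starM ss !cmulA.
exact: pos_starl.
Qed.

Lemma pos_tends u a : tends u a -> (forall n, pos (u n)) -> pos a.
Proof.
move=> ua pu; have sa : star a = a.
  by apply: (tends_unique _ ua); apply: tends_ext (tends_star ua) => n; case: (pu n).
split=> //; exists (nrm a + 1); first by have := nrm_ge0 a; lra.
have t1 : tends (fun n => sc (nrm a + 1) - u n) (sc (nrm a + 1) - a).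
  apply: tendsD; first exact: tends_cst.
  by apply: tends_squeeze ua _ => n; rewrite -opprD nrmN.
apply: tends_le t1 _.
have /cvgrPdist_le/(_ 1 ltr01) := tends_nrm ua; apply: filterS => n h.
have un : nrm (u n) <= nrm a + 1 by move: h; rewrite ler_norml; lra.
have t0 : 0 <= nrm a + 1 by rewrite addr_ge0 // nrm_ge0.
apply: pos_nrm_le => //; last by rewrite subKr.
by apply: pos_scB => //; case: (pu n).
Qed.

End Positivity.

(** * Inequalities between positive elements *)

Section Inequalities.
Context {R : realType} {A : cstarAlgType R}.
Implicit Types (a b c d p q x y z : A) (s t e : R).

(** The real sequence with steps c t^n and limit 0: the majorant of a geometric
iteration. *)
Definition geom_major (c t : R) (n : nat) : R := - (c * t ^+ n / (1 - t)).

Lemma geom_majorB (c t : R) n : t < 1 ->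
  geom_major c t n.+1 - geom_major c t n = c * t ^+ n.
Proof. by move=> t1; rewrite /geom_major exprS; field; rewrite subr_eq0 gt_eqF. Qed.

Lemma geom_major_cvg (c t : R) : 0 <= t -> t < 1 -> geom_major c t @ \oo --> 0.
Proof.
move=> t0 t1; rewrite -oppr0; apply: cvgN.
rewrite -(mul0r (1 - t)^-1); apply: cvgM; last exact: cvg_cst.
rewrite -(mulr0 c); apply: cvgM; first exact: cvg_cst.
by apply: cvg_expr; rewrite ger0_norm.
Qed.

Lemma one_sub_inv w : nrm w < 1 -> exists x, x = cone + w ** x.
Proof.
move=> w1; pose u := fix u n : A := if n is m.+1 then cone + w ** u m else 0.
have step n : nrm (u n.+1 - u n) <=
    geom_major 1 (nrm w) n.+1 - geom_major 1 (nrm w) n.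
  rewrite geom_majorB // mul1r; elim: n => [|n IH].
    by rewrite /= cmul0r addr0 subr0 nrm1_le1.
  have -> : u n.+2 - u n.+1 = w ** (u n.+1 - u n).
    by rewrite cmulBr [LHS]/= opprD addrACA subrr add0r.
  by apply: le_trans (nrmM _ _) _; rewrite exprS ler_wpM2l ?nrm_ge0.
have [x [ux _]] := majorant_tends (geom_major_cvg 1 (nrm_ge0 w) w1) step.
exists x; apply: tends_unique (tends_shift 1 ux) _.
apply: tends_ext (tendsD (tends_cst cone) (tendsM (tends_cst w) ux)) => n.
by rewrite addn1.
Qed.

Lemma pos_inv b e : pos b -> 0 < e -> exists g, (b + sc e) ** g = cone.
Proof.
move=> [sb [t t0 tb]] e0; have te0 : 0 < t + e by lra.
have w1 : nrm ((t + e)^-1%:C *: (sc t - b)) < 1.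
  rewrite nrmZr gtr0_norm ?invr_gt0 // mulrC ltr_pdivrMr // mul1r.
  by apply: le_lt_trans tb _; lra.
have [x ex] := one_sub_inv w1.
exists ((t + e)^-1%:C *: x); rewrite cmulZr -cmulZl.
have -> : (t + e)^-1%:C *: (b + sc e) = cone - (t + e)^-1%:C *: (sc t - b).
  have -> : b + sc e = sc (t + e) - (sc t - b).
    by rewrite opprB scD addrCA addrAC subrr add0r.
  rewrite scalerBr; congr (_ - _).
  by rewrite /sc scalerA -rmorphM mulVf ?gt_eqF // rmorph1 scale1r.
by rewrite cmulBl cmul1l {1}ex addrK.
Qed.

(** A norm inequality that holds after every conjugation p |-> a^* p a is an
inequality in A.  For e > 0 take a to be the inverse of the root s of b + e:
then a^* b a has norm at most 1, so a^* p a <= C, and conjugating back with s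
gives p <= C (b + e). *)
Lemma pos_le_of_nrm p b (C : R) : pos p -> pos b -> 0 <= C ->
  (forall a, nrm (star a ** p ** a) <= C * nrm (star a ** b ** a)) ->
  pos (C%:C *: b - p).
Proof.
move=> pp pb C0 h.
have shifted e : 0 < e -> pos (C%:C *: (b + sc e) - p).
  move=> e0; have pe : pos (sc e : A).
    by split; rewrite ?star_sc //; exists e => //; rewrite subrr nrm0 ltW.
  have [g bg] := pos_inv pb e0.
  have [s [[ss _] s2 _]] := pos_sqrt (posD pb pe).
  pose a := s ** g.
  have sa : s ** a = cone by rewrite cmulA s2.
  clearbody a.
  have as_ : star a ** s = cone by rewrite -{1}ss -starM sa star1.
  have aa : star a = a by rewrite -[LHS]cmul1r -sa cmulA as_ cmul1l.
  have as1 : a ** s = cone by rewrite -{1}aa.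
  have le1 : nrm (star a ** b ** a) <= 1.
    apply: le_trans nrm1_le1; apply: pos_le_nrm; first exact: pos_conj.
    have -> : cone - star a ** b ** a = e%:C *: (star a ** a).
      have <- : star a ** (b + sc e) ** a = cone by rewrite -s2 cmulA as_ cmul1l.
      by rewrite cmulDr cmulDl addrAC subrr add0r cmul_scr cmulZl.
    by apply: posZ (ltW e0) (pos_starl _).
  have leC : nrm (star a ** p ** a) <= C.
    by apply: le_trans (h a) _; rewrite ler_piMr.
  have spa : star (star a ** p ** a) = star a ** p ** a.
    by case: (pos_conj a pp).
  have := pos_conj s (pos_scB spa leC).
  rewrite ss cmulBr cmulBl cmul_scr cmulZl s2.
  by rewrite aa !cmulA sa cmul1l -cmulA as1 cmul1r.
apply: (@pos_tends _ _ (fun n => C%:C *: (b + sc n.+1%:R^-1) - p)).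
  apply: (@tends_squeeze _ _ _ _ (fun n => C * n.+1%:R^-1)).
    rewrite -(mulr0 C); apply: cvgM; first exact: cvg_cst.
    exact: cvg_harmonic.
  move=> n; rewrite opprB addrA subrK scalerDr addrC addrA addNr add0r.
  by rewrite nrmZr ger0_norm // ler_wpM2l // nrm_sc.
by move=> n; apply: shifted; rewrite invr_gt0.
Qed.

(** The hypothesis is the positivity of <x - y t b, x - y t b> for p = <x, x>,
q = <y, y>, b = <y, x>.  Since b^* q b <= m b^* b for m >= |q|, the choice
t = 1 / m leaves b^* b <= m p. *)
Lemma cauchy_schwarz_core p q b : pos q ->
  (forall t, pos (p - t%:C *: (star b ** b) - t%:C *: (star b ** b)
                  + (t ^+ 2)%:C *: (star b ** q ** b))) ->
  nrm b ^+ 2 <= nrm p * nrm q.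
Proof.
move=> pq h; have le m : nrm q <= m -> 0 < m -> nrm b ^+ 2 <= nrm p * m.
  move=> qm m0; have [sq _] := pq.
  have := pos_conj b (pos_scB sq qm); rewrite cmulBr cmulBl cmul_scr cmulZl.
  move=> /(posZ (sqr_ge0 m^-1)); rewrite scalerBr scalerA -rmorphM.
  have -> : m^-1 ^+ 2 * m = m^-1 by field; rewrite gt_eqF.
  move=> /(posD (h m^-1)); rewrite addrACA subrr addr0 subrK.
  move=> pX; have pX' : pos (m^-1%:C *: (star b ** b)).
    by apply: posZ (pos_starl b); rewrite invr_ge0 ltW.
  have := pos_le_nrm pX' pX.
  by rewrite nrmZr nrm_starl gtr0_norm ?invr_gt0 // mulrC ler_pdivrMr.
(* m = |q| is excluded when q = 0, so that bound is reached as a limit. *)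
apply/ler_addgt0Pr => e e0.
have np1 : 0 < nrm p + 1 by have := nrm_ge0 p; lra.
have d0 : 0 < e / (nrm p + 1) by rewrite divr_gt0.
have := le (nrm q + e / (nrm p + 1)); have := nrm_ge0 q => q0 /(_ _ _)/le_trans.
apply; [lra | lra |]; rewrite mulrDr lerD2l mulrA ler_pdivrMr //.
by rewrite mulrC ler_pM2l // lerDl.
Qed.

End Inequalities.

(** * Inner products over a finite range of indices *)

Section Windows.
Context {R : realType} {A : cstarAlgType R}.
Implicit Types (a b : A) (x y z : nat -> A) (e : R).

Lemma rscaleZ1 x (k : R[i]) : rscale x (k *: cone) = k *: x.
Proof. by apply/funext => i; rewrite /rscale cmulZr cmul1r. Qed.

Lemma rscaleDl x y a : rscale (x + y) a = rscale x a + rscale y a.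
Proof. by apply/funext => i; rewrite /rscale cmulDl. Qed.

Lemma rscaleDr x a b : rscale x (a + b) = rscale x a + rscale x b.
Proof. by apply/funext => i; rewrite /rscale cmulDr. Qed.

Lemma rscaleNl x a : rscale (- x) a = - rscale x a.
Proof. by apply/funext => i; rewrite /rscale cmulNl. Qed.

Lemma rscaleM x a b : rscale (rscale x a) b = rscale x (a ** b).
Proof. by apply/funext => i; rewrite /rscale cmulA. Qed.

(** All estimates on l2 come from finite ranges N <= i < M: ranges starting at 0
approximate the inner product, and those starting far away its tails. *)
Definition wip (N M : nat) x y : A := \sum_(N <= i < M) star (x i) ** y i.
Definition wnrm N M x : R := Num.sqrt (nrm (wip N M x x)).

Lemma wip_pos N M x : pos (wip N M x x).
Proof. by apply: pos_sum => i _; exact: pos_starl. Qed.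

Lemma wip_star N M x y : star (wip N M x y) = wip N M y x.
Proof. by rewrite star_sum; apply: eq_bigr => i _; rewrite starM starK. Qed.

Lemma wipDr N M x y z : wip N M x (y + z) = wip N M x y + wip N M x z.
Proof. by rewrite -big_split; apply: eq_bigr => i _ /=; rewrite -cmulDr. Qed.

Lemma wipDl N M x y z : wip N M (x + y) z = wip N M x z + wip N M y z.
Proof. by rewrite -wip_star wipDr starD !wip_star. Qed.

Lemma wipr N M x y a : wip N M x (rscale y a) = wip N M x y ** a.
Proof. by rewrite cmul_suml; apply: eq_bigr => i _; rewrite cmulA. Qed.

Lemma wipl N M x y a : wip N M (rscale x a) y = star a ** wip N M x y.
Proof. by rewrite -wip_star wipr starM wip_star. Qed.

Lemma wnrm_ge0 N M x : 0 <= wnrm N M x.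
Proof. exact: sqrtr_ge0. Qed.

Lemma wnrm_sqr N M x : wnrm N M x ^+ 2 = nrm (wip N M x x).
Proof. by rewrite sqr_sqrtr // nrm_ge0. Qed.

(** Cauchy-Schwarz inequality on a finite range. *)
Lemma wip_le N M x y : nrm (wip N M x y) <= wnrm N M x * wnrm N M y.
Proof.
rewrite -(@ler_pXn2r _ 2) ?nnegrE ?mulr_ge0 ?wnrm_ge0 ?nrm_ge0 //.
rewrite exprMn !wnrm_sqr mulrC; apply: cauchy_schwarz_core; first exact: wip_pos.
move=> t; set b := wip N M x y.
have -> : wip N M y y - t%:C *: (star b ** b) - t%:C *: (star b ** b)
    + (t ^+ 2)%:C *: (star b ** wip N M x x ** b)
  = wip N M (y + rscale x ((- t)%:C *: b)) (y + rscale x ((- t)%:C *: b)).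
  rewrite wipDr !wipDl !wipr !wipl -/b -(wip_star _ _ x y) -/b.
  rewrite starZr !cmulZr !cmulZl scalerA -rmorphM mulrNN -expr2.
  by rewrite rmorphN !scaleNr !addrA.
exact: wip_pos.
Qed.

Lemma wnrm_leP N M x c : 0 <= c -> (wnrm N M x <= c) = (nrm (wip N M x x) <= c ^+ 2).
Proof. by move=> c0; rewrite -wnrm_sqr ler_pXn2r // nnegrE wnrm_ge0. Qed.

Lemma wnrmD N M x y : wnrm N M (x + y) <= wnrm N M x + wnrm N M y.
Proof.
have x0 := wnrm_ge0 N M x; have y0 := wnrm_ge0 N M y.
rewrite wnrm_leP ?addr_ge0 // wipDr !wipDl.
have h1 := wip_le N M x y; have h2 := wip_le N M y x.
have h3 := wip_le N M x x; have h4 := wip_le N M y y.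
have h5 := ler_nrmD (wip N M x x) (wip N M y x).
have h6 := ler_nrmD (wip N M x y) (wip N M y y).
apply: (le_trans (ler_nrmD _ _)).
by rewrite sqrrD; move: h1 h2 h3 h4 h5 h6; rewrite -!expr2; lra.
Qed.

Lemma wnrmr N M x a : wnrm N M (rscale x a) <= wnrm N M x * nrm a.
Proof.
rewrite wnrm_leP ?mulr_ge0 ?wnrm_ge0 ?nrm_ge0 // wipl wipr.
apply: le_trans (nrmM _ _) _; rewrite nrm_star exprMn wnrm_sqr mulrC expr2 mulrA.
by rewrite ler_wpM2r ?nrm_ge0 ?nrmM.
Qed.

Lemma wnrm_mono N N' M x : (N <= N')%N -> wnrm N' M x <= wnrm N M x.
Proof.
move=> NN'; rewrite wnrm_leP ?wnrm_ge0 // wnrm_sqr; apply: pos_le_nrm.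
  exact: wip_pos.
have [NM|/ltnW MN] := leqP N' M; last first.
  have -> : wip N' M x x = 0 by rewrite /wip big_geq.
  by rewrite subr0; exact: wip_pos.
have -> : wip N M x x = wip N N' x x + wip N' M x x by rewrite /wip -big_cat_nat.
by rewrite addrK; exact: wip_pos.
Qed.

End Windows.

(** * The Hilbert module l2(A) *)

Section L2.
Context {R : realType} {A : cstarAlgType R}.
Implicit Types (a b : A) (x y z : nat -> A) (e c : R).

Lemma wip_series x y n : series (fun i => star (x i) ** y i) n = wip 0 n x y.
Proof. by []. Qed.

Lemma wip_split N M x y : (N <= M)%N -> wip 0 M x y = wip 0 N x y + wip N M x y.
Proof. by move=> NM; rewrite /wip -big_cat_nat. Qed.

(** Membership in l2 as a Cauchy condition on tails, which the triangle inequality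
of wnrm can handle. *)
Lemma l2P x : l2 A x <-> forall e, 0 < e -> exists N, forall M, wnrm N M x <= e.
Proof.
split=> [/cvg_ex[l /tendsE/tendsP h] e e0|h].
  have e2 : 0 < e ^+ 2 / 2 by rewrite divr_gt0 // exprn_gt0.
  have [N hN] := h _ e2.
  exists N => M; have [NM|/ltnW MN] := leqP N M; last first.
    by rewrite /wnrm /wip big_geq // nrm0 sqrtr0 ltW.
  rewrite wnrm_leP; last exact: ltW.
  have -> : wip N M x x = (wip 0 M x x - l) - (wip 0 N x x - l).
    by rewrite opprB addrA subrK (wip_split _ _ NM) addrC addKr.
  apply: le_trans (ler_nrmB _ _) _.
  have := hN N (leqnn N); have := hN M NM; rewrite !wip_series => h1 h2.
  by rewrite [leRHS]splitr lerD.
suff [l /tendsE hl] : exists l, tends (series (fun i => star (x i) ** x i)) l.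
  by apply/cvg_ex; exists l.
apply: cauchy_tends => e e0.
have se0 : 0 < Num.sqrt e by rewrite sqrtr_gt0.
have [N hN] := h _ se0.
exists N => n Nn; rewrite !wip_series (wip_split _ _ Nn) addrC addKr.
rewrite -wnrm_sqr -[leRHS]sqr_sqrtr ?(ltW e0) //.
by rewrite ler_pXn2r ?nnegrE ?wnrm_ge0 ?sqrtr_ge0.
Qed.

Lemma l2_0 : l2 A 0.
Proof.
apply/l2P => e e0; exists 0 => M; apply: le_trans _ (ltW e0).
by rewrite /wnrm /wip big1 ?nrm0 ?sqrtr0 // => i _; rewrite cmul0r.
Qed.

Lemma l2D x y : l2 A x -> l2 A y -> l2 A (x + y).
Proof.
move=> /l2P hx /l2P hy; apply/l2P => e e0.
have e2 : 0 < e / 2 by rewrite divr_gt0.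
have [N hN] := hx _ e2; have [K hK] := hy _ e2; exists (maxn N K) => M.
rewrite [leRHS]splitr; apply: le_trans (wnrmD _ _ _ _) _; apply: lerD.
  by apply: le_trans (hN M); apply: wnrm_mono; exact: leq_maxl.
by apply: le_trans (hK M); apply: wnrm_mono; exact: leq_maxr.
Qed.

Lemma l2r x a : l2 A x -> l2 A (rscale x a).
Proof.
move=> /l2P hx; apply/l2P => e e0.
have a1 : 0 < nrm a + 1 by have := nrm_ge0 a; lra.
have [N hN] := hx _ (divr_gt0 e0 a1); exists N => M.
apply: le_trans (wnrmr _ _ _ _) _.
apply: le_trans (_ : wnrm N M x * (nrm a + 1) <= _).
  by rewrite ler_wpM2l ?wnrm_ge0 // lerDl.
by rewrite -ler_pdivlMr.
Qed.

Lemma l2Z (k : R[i]) x : l2 A x -> l2 A (k *: x).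
Proof. by rewrite -rscaleZ1; exact: l2r. Qed.

Lemma l2N x : l2 A x -> l2 A (- x).
Proof. by rewrite -scaleN1r; exact: l2Z. Qed.

Lemma l2B x y : l2 A x -> l2 A y -> l2 A (x - y).
Proof. by move=> hx hy; apply: l2D => //; exact: l2N. Qed.

Lemma l2_sum (I : Type) (r : seq I) (P : pred I) (f : I -> nat -> A) :
  (forall i, P i -> l2 A (f i)) -> l2 A (\sum_(i <- r | P i) f i).
Proof. by move=> h; elim/big_ind: _ => //; [exact: l2_0 | exact: l2D]. Qed.

Lemma tends_inner x y : l2 A x -> l2 A y -> tends (fun n => wip 0 n x y) (inner x y).
Proof.
move=> /l2P hx /l2P hy.
suff [l hl] : exists l, tends (fun n => wip 0 n x y) l.
  by have -> : inner x y = l by apply: cvg_lim => //; apply/tendsE.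
apply: cauchy_tends => e e0.
have [N hN] := hx _ ltr01; have [K hK] := hy _ e0.
exists (maxn N K) => n Nn; rewrite (wip_split _ _ Nn) addrC addKr.
apply: le_trans (wip_le _ _ _ _) _; rewrite -[e]mul1r.
apply: ler_pM; rewrite ?wnrm_ge0 //.
  by apply: le_trans (hN n); apply: wnrm_mono; exact: leq_maxl.
by apply: le_trans (hK n); apply: wnrm_mono; exact: leq_maxr.
Qed.

Lemma innerDr x y z : l2 A x -> l2 A y -> l2 A z ->
  inner x (y + z) = inner x y + inner x z.
Proof.
move=> hx hy hz; apply: tends_unique (tends_inner hx (l2D hy hz)) _.
by apply: tends_ext (tendsD (tends_inner hx hy) (tends_inner hx hz)) => n; rewrite wipDr.
Qed.

Lemma inner_star x y : l2 A x -> l2 A y -> star (inner x y) = inner y x.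
Proof.
move=> hx hy; apply: (tends_unique _ (tends_inner hy hx)).
by apply: tends_ext (tends_star (tends_inner hx hy)) => n; rewrite wip_star.
Qed.

Lemma innerr x y a : l2 A x -> l2 A y -> inner x (rscale y a) = inner x y ** a.
Proof.
move=> hx hy; apply: tends_unique (tends_inner hx (l2r hy)) _.
by apply: tends_ext (tendsM (tends_inner hx hy) (tends_cst a)) => n; rewrite wipr.
Qed.

Lemma innerl x y a : l2 A x -> l2 A y -> inner (rscale x a) y = star a ** inner x y.
Proof.
move=> hx hy; rewrite -inner_star //; last exact: l2r.
by rewrite innerr // starM inner_star.
Qed.

Lemma innerDl x y z : l2 A x -> l2 A y -> l2 A z ->
  inner (x + y) z = inner x z + inner y z.
Proof.
move=> hx hy hz; rewrite -inner_star ?innerDr ?starD ?inner_star //; exact: l2D.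
Qed.

Lemma innerNr x y : l2 A x -> l2 A y -> inner x (- y) = - inner x y.
Proof.
by move=> hx hy; rewrite -scaleN1r -rscaleZ1 innerr // cmulZr cmul1r scaleN1r.
Qed.

Lemma innerNl x y : l2 A x -> l2 A y -> inner (- x) y = - inner x y.
Proof.
by move=> hx hy; rewrite -inner_star ?innerNr ?starN ?inner_star //; exact: l2N.
Qed.

Lemma innerBr x y z : l2 A x -> l2 A y -> l2 A z ->
  inner x (y - z) = inner x y - inner x z.
Proof. by move=> hx hy hz; rewrite innerDr ?innerNr //; exact: l2N. Qed.

Lemma innerBl x y z : l2 A x -> l2 A y -> l2 A z ->
  inner (x - y) z = inner x z - inner y z.
Proof. by move=> hx hy hz; rewrite innerDl ?innerNl //; exact: l2N. Qed.

Lemma inner0r x : l2 A x -> inner x 0 = 0.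
Proof.
move=> hx; rewrite -(scale0r (0 : nat -> A)) -rscaleZ1 innerr ?scale0r ?cmul0r //.
exact: l2_0.
Qed.

Lemma inner_sumr (I : Type) (r : seq I) (P : pred I) (f : I -> nat -> A) x :
  l2 A x -> (forall i, l2 A (f i)) ->
  inner x (\sum_(i <- r | P i) f i) = \sum_(i <- r | P i) inner x (f i).
Proof.
move=> hx hf; elim: r => [|i r IH]; first by rewrite !big_nil inner0r.
by rewrite !big_cons; case: (P i) => //; rewrite innerDr ?IH //; exact: l2_sum.
Qed.

Lemma inner_pos x : l2 A x -> pos (inner x x).
Proof. by move=> hx; apply: pos_tends (tends_inner hx hx) _ => n; exact: wip_pos. Qed.

Lemma l2norm_ge0 x : 0 <= l2norm x.
Proof. exact: sqrtr_ge0. Qed.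

Lemma l2norm_sqr x : l2norm x ^+ 2 = nrm (inner x x).
Proof. by rewrite sqr_sqrtr // nrm_ge0. Qed.

Lemma wnrm_le_l2norm N M x : l2 A x -> wnrm N M x <= l2norm x.
Proof.
move=> hx; apply: le_trans (wnrm_mono _ _ (leq0n N)) _.
rewrite wnrm_leP ?l2norm_ge0 // l2norm_sqr; apply: pos_le_nrm; first exact: wip_pos.
have t1 := tendsD (tends_shift M (tends_inner hx hx)) (tends_cst (- wip 0 M x x)).
apply: pos_tends t1 _ => n.
rewrite (@wip_split M (n + M)) ?leq_addl // addrC addKr; exact: wip_pos.
Qed.

Lemma l2norm_le x c : l2 A x -> 0 <= c -> (forall M, wnrm 0 M x <= c) -> l2norm x <= c.
Proof.
move=> hx c0 h; rewrite -(@ler_pXn2r _ 2) ?nnegrE ?l2norm_ge0 // l2norm_sqr.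
apply: tends_le (tends_inner hx hx) _; near=> n.
by rewrite -wnrm_leP.
Unshelve. all: by end_near. Qed.

Lemma l2normD x y : l2 A x -> l2 A y -> l2norm (x + y) <= l2norm x + l2norm y.
Proof.
move=> hx hy; apply: l2norm_le => [||M]; first exact: l2D.
  by rewrite addr_ge0 ?l2norm_ge0.
by apply: le_trans (wnrmD _ _ _ _) _; rewrite lerD ?wnrm_le_l2norm.
Qed.

Lemma l2normr x a : l2 A x -> l2norm (rscale x a) <= l2norm x * nrm a.
Proof.
move=> hx; apply: l2norm_le => [||M]; first exact: l2r.
  by rewrite mulr_ge0 ?l2norm_ge0 ?nrm_ge0.
by apply: le_trans (wnrmr _ _ _ _) _; rewrite ler_wpM2r ?nrm_ge0 ?wnrm_le_l2norm.
Qed.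

Lemma inner_le x y : l2 A x -> l2 A y -> nrm (inner x y) <= l2norm x * l2norm y.
Proof.
move=> hx hy; apply: tends_le (tends_inner hx hy) _; near=> n.
apply: le_trans (wip_le _ _ _ _) _.
by apply: ler_pM; rewrite ?wnrm_ge0 ?wnrm_le_l2norm.
Unshelve. all: by end_near. Qed.

Lemma l2normZ (k : R[i]) x : l2 A x -> l2norm (k *: x) = complex.Re `|k| * l2norm x.
Proof.
move=> hx; have k0 : 0 <= complex.Re `|k| by rewrite -ler0c RRe_real ?normr_real.
apply/eqP; rewrite -(@eqrXn2 _ 2) ?mulr_ge0 ?l2norm_ge0 // exprMn !l2norm_sqr.
rewrite -rscaleZ1 innerl ?innerr //; last exact: l2r.
by rewrite starZ star1 !cmulZl cmul1l cmulZr cmul1r !nrmZ norm_conjC mulrA expr2.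
Qed.

Lemma l2normN x : l2norm (- x) = l2norm x.
Proof.
rewrite /l2norm /inner; congr (Num.sqrt (complex.Re `|limn _|)).
by apply/funext => n; apply: eq_bigr => i _; rewrite starN cmulNl cmulNr opprK.
Qed.

Lemma l2norm0 : l2norm (0 : nat -> A) = 0.
Proof. by rewrite -(scale0r (0 : nat -> A)) l2normZ ?normr0 ?mul0r //; exact: l2_0. Qed.

Lemma nrm_le_l2norm x i : l2 A x -> nrm (x i) <= l2norm x.
Proof.
move=> hx; apply: le_trans (wnrm_le_l2norm i i.+1 hx).
by rewrite /wnrm /wip big_nat1 nrm_starl sqrtr_sqr ger0_norm ?nrm_ge0.
Qed.

Lemma l2norm_eq0 x : l2 A x -> l2norm x <= 0 -> x = 0.
Proof.
move=> hx x0; apply/funext => i; apply: nrm_eq0; apply/eqP.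
by rewrite eq_le nrm_ge0 andbT; apply: le_trans x0; exact: nrm_le_l2norm.
Qed.

Lemma l2norm_sum (I : Type) (r : seq I) (f : I -> nat -> A) :
  (forall i, l2 A (f i)) -> l2norm (\sum_(i <- r) f i) <= \sum_(i <- r) l2norm (f i).
Proof.
move=> hf; elim: r => [|i r IH]; first by rewrite !big_nil l2norm0.
by rewrite !big_cons (le_trans (l2normD _ _)) ?lerD //; exact: l2_sum.
Qed.

Lemma inner_ext x y : l2 A x -> l2 A y ->
  (forall z, l2 A z -> inner z x = inner z y) -> x = y.
Proof.
move=> hx hy h; apply/eqP; rewrite -subr_eq0; apply/eqP.
have hxy := l2B hx hy; apply: l2norm_eq0 => //.
have /eqP : l2norm (x - y) ^+ 2 = 0.
  by rewrite l2norm_sqr innerBr // h // subrr nrm0.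
by rewrite sqrf_eq0 => /eqP ->.
Qed.

Lemma tends_sum (r : seq nat) (u : nat -> nat -> A) (l : nat -> A) :
  (forall i, tends (fun n => u n i) (l i)) ->
  tends (fun n => \sum_(i <- r) u n i) (\sum_(i <- r) l i).
Proof.
move=> h; elim: r => [|i r IH].
  by rewrite big_nil; apply: tends_ext (tends_cst 0) => n; rewrite big_nil.
by rewrite big_cons; apply: tends_ext (tendsD (h i) IH) => n; rewrite big_cons.
Qed.

(** The coordinates converge, and the bounds on the finite ranges pass to the
limit; they are uniform in the range, which gives both membership in l2 and
the estimate of the norm. *)
Lemma l2_complete (u : nat -> nat -> A) (f : nat -> R) (E : R) :
  (forall n, l2 A (u n)) -> f @ \oo --> E ->
  (forall n, l2norm (u n.+1 - u n) <= f n.+1 - f n) ->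
  exists x, l2 A x /\ forall n, l2norm (x - u n) <= E - f n.
Proof.
move=> hu fE step.
have fnd : nondecreasing_seq f.
  apply/nondecreasing_seqP => n; rewrite -subr_ge0.
  exact: le_trans (l2norm_ge0 _) (step n).
have fleE n : 0 <= E - f n.
  rewrite subr_ge0 -(cvg_lim _ fE) //.
  by apply: nondecreasing_cvgn_le => //; exact: cvgP fE.
have leD n k : l2norm (u (n + k)%N - u n) <= f (n + k)%N - f n.
  elim: k => [|k IH]; first by rewrite addn0 !subrr l2norm0.
  rewrite addnS -(subrK (u (n + k)%N) (u _.+1)) -addrA.
  apply: le_trans (l2normD _ _) _; try exact: l2B.
  by rewrite -(subrK (f (n + k)%N) (f _.+1)) -[leRHS]addrA lerD.
have coord i : exists l, tends (fun n => u n i) l.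
  have [n|l [hl _]] := @majorant_tends _ _ (fun n => u n i) f E fE; last by exists l.
  by apply: le_trans (step n); apply: (@nrm_le_l2norm (u n.+1 - u n)); exact: l2B.
have [x hx] := choice coord.
have wle n M N : wnrm N M (x - u n) <= E - f n.
  rewrite wnrm_leP //.
  have tw : tends (fun k => wip N M (u (k + n)%N - u n) (u (k + n)%N - u n))
                  (wip N M (x - u n) (x - u n)).
    apply: tends_sum => i; apply: tendsM; last first.
      by apply: tendsD (tends_shift n (hx i)) (tends_cst _).
    by apply: tends_star; apply: tendsD (tends_shift n (hx i)) (tends_cst _).
  apply: tends_le tw _; near=> k; rewrite -wnrm_leP //.
  apply: le_trans (wnrm_le_l2norm _ _ _) _; first exact: l2B.
  by rewrite addnC; apply: le_trans (leD _ _) _; rewrite lerD2r -subr_ge0.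
have l2x : l2 A x.
  apply/l2P => e e0; have e2 : 0 < e / 2 by rewrite divr_gt0.
  have /cvgrPdist_le/(_ _ e2) [n _ /(_ n (leqnn n)) /=] := fE.
  rewrite ger0_norm ?fleE // => hn.
  have /l2P/(_ _ e2) [N hN] := hu n; exists N => M.
  rewrite -(subrK (u n) x) [leRHS]splitr; apply: le_trans (wnrmD _ _ _ _) _.
  by apply: lerD => //; apply: le_trans (wle _ _ _) hn.
exists x; split=> // n; apply: l2norm_le => //; exact: l2B.
Unshelve. all: by end_near. Qed.

End L2.

(** * Bounded linear and adjointable operators *)

Local Notation blin T := (bounded_linear (l2 _) (l2 _) T).

Section Operators.
Context {R : realType} {A : cstarAlgType R}.
Implicit Types (a b : A) (x y z : nat -> A) (e c t : R).
Implicit Types (S T V W : (nat -> A) -> nat -> A).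

Lemma blin_l2 T x : blin T -> l2 A x -> l2 A (T x).
Proof. by case=> h _ _ _; exact: h. Qed.

Lemma blinD T x y : blin T -> l2 A x -> l2 A y -> T (x + y) = T x + T y.
Proof. by case=> _ h _ _; exact: h. Qed.

Lemma blinr T x a : blin T -> l2 A x -> T (rscale x a) = rscale (T x) a.
Proof. by case=> _ _ h _; exact: h. Qed.

Lemma blinZ T (k : R[i]) x : blin T -> l2 A x -> T (k *: x) = k *: T x.
Proof. by move=> hT hx; rewrite -rscaleZ1 (blinr _ hT) // rscaleZ1. Qed.

Lemma blinN T x : blin T -> l2 A x -> T (- x) = - T x.
Proof. by move=> hT hx; rewrite -scaleN1r (blinZ _ hT) // scaleN1r. Qed.

Lemma blinB T x y : blin T -> l2 A x -> l2 A y -> T (x - y) = T x - T y.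
Proof. by move=> hT hx hy; rewrite (blinD hT hx (l2N hy)) (blinN hT hy). Qed.

Lemma blin0 T : blin T -> T 0 = 0.
Proof.
by move=> hT; rewrite -(scale0r (0 : nat -> A)) (blinZ _ hT) ?scale0r //; exact: l2_0.
Qed.

Lemma blin_bound T : blin T -> exists2 c, 0 <= c & bounded_by (l2 A) T c.
Proof.
case=> _ _ _ [c hc]; exists `|c| => // x hx; apply: le_trans (hc x hx) _.
by rewrite ler_wpM2r ?l2norm_ge0 ?ler_norm.
Qed.

Lemma blin_comp S T : blin S -> blin T -> blin (S \o T).
Proof.
move=> hS hT; have [c c0 hc] := blin_bound hS; have [d d0 hd] := blin_bound hT.
split=> [x hx|x y hx hy|x a hx|] /=.
- exact/blin_l2/blin_l2.
- by rewrite (blinD hT) // (blinD hS) //; exact: blin_l2.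
- by rewrite (blinr _ hT) // (blinr _ hS) //; exact: blin_l2.
- exists (c * d) => x hx; apply: le_trans (hc _ (blin_l2 hT hx)) _.
  by rewrite -mulrA ler_wpM2l // hd.
Qed.

Lemma blin_add S T : blin S -> blin T -> blin (fun x => S x + T x).
Proof.
move=> hS hT; have [c c0 hc] := blin_bound hS; have [d d0 hd] := blin_bound hT.
split=> [x hx|x y hx hy|x a hx|] /=.
- by apply: l2D; exact: blin_l2.
- by rewrite (blinD hS) // (blinD hT) // addrACA.
- by rewrite (blinr _ hS) // (blinr _ hT) // rscaleDl.
- exists (c + d) => x hx; apply: le_trans (l2normD _ _) _; try exact: blin_l2.
  by rewrite mulrDl; apply: lerD; [exact: hc | exact: hd].
Qed.

Lemma blin_id : bounded_linear (l2 A) (l2 A) id.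
Proof. by split=> //; exists 1 => x _; rewrite mul1r. Qed.

Lemma blin_opp T : blin T -> blin (fun x => - T x).
Proof.
move=> hT; have [c c0 hc] := blin_bound hT.
split=> [x hx|x y hx hy|x a hx|] /=.
- by apply: l2N; exact: blin_l2.
- by rewrite (blinD hT) // opprD.
- by rewrite (blinr _ hT) // rscaleNl.
- by exists c => x hx; rewrite l2normN hc.
Qed.

Lemma blin_scale t T : blin T -> blin (fun x => t%:C *: T x).
Proof.
move=> hT; have [c c0 hc] := blin_bound hT.
split=> [x hx|x y hx hy|x a hx|] /=.
- by apply: l2Z; exact: blin_l2.
- by rewrite (blinD hT) // scalerDr.
- by rewrite (blinr _ hT) //; apply/funext => i; rewrite /rscale /= cmulZl.
- exists (complex.Re `|t%:C| * c) => x hx; rewrite l2normZ; last exact: blin_l2.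
  rewrite -mulrA; apply: ler_wpM2l; last exact: hc.
  by rewrite -ler0c RRe_real ?normr_real.
Qed.

Lemma fixpoint_unique W t x y : blin W -> t < 1 -> bounded_by (l2 A) W t ->
  l2 A x -> l2 A y -> x - W x = y - W y -> x = y.
Proof.
move=> hW t1 Wt hx hy e; apply/eqP; rewrite -subr_eq0; apply/eqP.
have hxy := l2B hx hy; apply: l2norm_eq0 => //.
have := Wt _ hxy; have -> : W (x - y) = x - y.
  rewrite (blinB hW) //; apply/eqP; rewrite eq_sym -subr_eq0 opprD opprK addrACA e.
  by rewrite addrACA subrr addNr addr0.
by have := l2norm_ge0 (x - y); nra.
Qed.

(** The solution V y of x = y + W x is the limit of the iteration
x |-> y + W x; V is linear because solutions are unique. *)
Lemma neumann W t : blin W -> 0 <= t -> t < 1 -> bounded_by (l2 A) W t ->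
  exists V, blin V /\ forall y, l2 A y -> V y - W (V y) = y.
Proof.
move=> hW t0 t1 Wt.
have exV y : exists x, l2 A y -> l2 A x /\ x - W x = y.
  have [hy|ny] := pselect (l2 A y); last by exists 0.
  pose u := fix u n := if n is m.+1 then y + W (u m) else 0.
  have hu n : l2 A (u n).
    by elim: n => [|n IH] /=; [exact: l2_0 | apply: l2D => //; exact: blin_l2].
  pose f := geom_major (l2norm y) t.
  have step n : l2norm (u n.+1 - u n) <= f n.+1 - f n.
    rewrite geom_majorB //; elim: n => [|n IH].
      by rewrite /= (blin0 hW) addr0 subr0 mulr1.
    have -> : u n.+2 - u n.+1 = W (u n.+1 - u n).
      by rewrite (blinB hW) // [LHS]/= opprD addrACA subrr add0r.
    by apply: le_trans (Wt _ (l2B (hu _) (hu _))) _; rewrite exprS mulrCA ler_wpM2l.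
  have cf := geom_major_cvg (l2norm y) t0 t1.
  have [x [hx ex]] := l2_complete hu cf step.
  exists x => _; split=> //; apply/eqP; rewrite -subr_eq0; apply/eqP.
  have hWx := blin_l2 hW hx.
  apply: l2norm_eq0; first by apply: l2B => //; exact: l2B.
  pose G n := (0 - f n.+1) + t * (0 - f n).
  have cG : G @ \oo --> (0 : R).
    rewrite -[X in _ --> X](_ : (0 - 0) + t * (0 - 0) = 0); last by ring.
    apply: cvgD; last first.
      by apply: cvgM; [exact: cvg_cst | apply: cvgB => //; exact: cvg_cst].
    by apply: cvgB; [exact: cvg_cst | rewrite (cvg_shiftS f)].
  suff : l2norm (x - W x - y) <= lim (G @ \oo) by rewrite (cvg_lim _ cG).
  apply: limr_ge; first exact: cvgP cG.
  near=> n.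
  have -> : x - W x - y = (x - u n.+1) - W (x - u n).
    by rewrite (blinB hW) //= !opprD opprK !addrA [RHS]addrAC subrK addrAC.
  apply: le_trans (l2normD _ _) _; first exact: l2B.
    by apply: l2N; apply: blin_l2 => //; exact: l2B.
  rewrite l2normN; apply: lerD => //.
  by apply: le_trans (Wt _ (l2B hx (hu n))) _; rewrite ler_wpM2l.
have [V hV] := choice exV; exists V; split; last by move=> y /hV[].
have V2 y : l2 A y -> l2 A (V y) by move=> /hV[].
have uniq x y : l2 A x -> l2 A y -> x - W x = y -> V y = x.
  move=> hx hy e; apply: (fixpoint_unique hW t1 Wt) => //; first exact: V2.
  by rewrite e; case: (hV y hy).
split=> // [x y hx hy|x a hx|].
- apply: uniq; [by apply: l2D; exact: V2 | exact: l2D |].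
  rewrite (blinD hW (V2 _ hx) (V2 _ hy)) opprD addrACA.
  by have [_ ->] := hV x hx; have [_ ->] := hV y hy.
- apply: uniq; [by apply: l2r; exact: V2 | exact: l2r |].
  rewrite (blinr _ hW (V2 _ hx)).
  by rewrite -rscaleNl -rscaleDl; have [_ ->] := hV x hx.
- exists (1 - t)^-1 => x hx; have [hVx e] := hV x hx.
  have := l2normD hx (blin_l2 hW hVx); rewrite -{1}e subrK => h.
  have := Wt _ hVx => h'; rewrite mulrC ler_pdivlMr ?subr_gt0 //.
  by move: h h'; set p := l2norm (V x); set q := l2norm x; nra.
Unshelve. all: by end_near. Qed.

Lemma adjointable_adjoint T : adjointable T -> exists S, adjointable S /\
  (forall x y, l2 A x -> l2 A y -> inner (T x) y = inner x (S y)).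
Proof.
case=> hT [S [hS TS]]; exists S; split=> //.
have ST x y : l2 A x -> l2 A y -> inner (S x) y = inner x (T y).
  move=> hx hy; rewrite -(inner_star hy (hS _ hx)) -(TS _ _ hy hx) inner_star //.
  exact: blin_l2.
split; last by exists T; split=> // y; exact: blin_l2.
split=> // [x y hx hy|x a hx|].
- apply: inner_ext; [by apply/hS/l2D | by apply: l2D; exact: hS |] => z hz.
  have hTz := blin_l2 hT hz.
  by rewrite innerDr -?TS ?innerDr //; [exact: l2D | exact: hS | exact: hS].
- apply: inner_ext; [by apply/hS/l2r | by apply: l2r; exact: hS |] => z hz.
  have hTz := blin_l2 hT hz.
  by rewrite innerr -?TS ?innerr //; [exact: l2r | exact: hS].
- have [c c0 hc] := blin_bound hT; exists c => y hy.
  have hSy := hS y hy; have hTSy := blin_l2 hT hSy.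
  have := inner_le hTSy hy; rewrite TS // -l2norm_sqr => h.
  have := hc _ hSy; have := l2norm_ge0 (S y); have := l2norm_ge0 y.
  move: h; set p := l2norm (S y); set q := l2norm y; set r := l2norm (T _).
  move=> h q0 p0 h'; have : p ^+ 2 <= c * q * p by nra.
  have [-> _|p1] := eqVneq p 0; first by rewrite mulr_ge0.
  by rewrite expr2 ler_pM2r // lt_def p1.
Qed.

Lemma adjointable_comp S T : adjointable S -> adjointable T -> adjointable (S \o T).
Proof.
move=> [hS [S' [hS' eS]]] [hT [T' [hT' eT]]]; split; first exact: blin_comp.
exists (T' \o S'); split=> [y /hS'/hT' //|x y hx hy] /=.
by rewrite eS ?eT //; [exact: hS' | exact: blin_l2].
Qed.

Lemma adjointable_subid T : adjointable T -> adjointable (fun x => T x - x).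
Proof.
move=> [hT [T' [hT' eT]]]; split; first exact: (blin_add hT (blin_opp blin_id)).
exists (fun x => T' x - x); split=> [y hy|x y hx hy].
  by apply: l2B => //; exact: hT'.
by rewrite innerBl ?innerBr ?eT //; [exact: hT' | exact: blin_l2].
Qed.

End Operators.

(** * Invertibility of positive operators that are bounded below *)

Section Invert.
Context {R : realType} {A : cstarAlgType R}.
Implicit Types (a b : A) (x y z : nat -> A) (e c t : R).
Implicit Types (S T V W : (nat -> A) -> nat -> A).

(** Of the two vectors z + r y and z - r y one does the job: their inner products
with y differ by 2 r <y, y>, whose norm is 2 r. *)
Lemma hump (r : R) y z : l2 A y -> l2 A z -> l2norm y = 1 -> 0 <= r ->
  exists z', [/\ l2 A z', l2norm (z' - z) <= r & r <= nrm (inner y z')].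
Proof.
move=> hy hz y1 r0; have hry : l2 A (r%:C *: y) by exact: l2Z.
have nry : l2norm (r%:C *: y) = r.
  by rewrite l2normZ // y1 mulr1 normc_def /= expr0n addr0 sqrtr_sqr ger0_norm.
have yry : nrm (inner y (r%:C *: y)) = r.
  rewrite -rscaleZ1 innerr // cmulZr cmul1r nrmZr -l2norm_sqr y1 expr1n mulr1.
  by rewrite ger0_norm.
have := ler_nrmB (inner y (z + r%:C *: y)) (inner y (z - r%:C *: y)).
have -> : inner y (z + r%:C *: y) - inner y (z - r%:C *: y) =
    inner y (r%:C *: y) + inner y (r%:C *: y).
  by rewrite innerDr // innerBr // opprB addrC addrA subrK.
rewrite nrm_double yry => h.
have [le|lt] := leP r (nrm (inner y (z + r%:C *: y))).
  exists (z + r%:C *: y); split=> //; first exact: l2D.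
  by rewrite addrC addKr nry.
exists (z - r%:C *: y); split=> //; first exact: l2B.
  by rewrite addrC addKr l2normN nry.
lra.
Qed.

(** Adding successive humps of size 3^-k: the k-th one makes the norm of
<y_k, z> at least 3^-k, and the later ones have total size at most 3^-k / 2. *)
Lemma hump_sequence (y : nat -> nat -> A) :
  (forall k, l2 A (y k)) -> (forall k, l2norm (y k) = 1) ->
  exists2 z, l2 A z & forall k, 3^-1 ^+ k / 2 <= nrm (inner (y k) z).
Proof.
move=> hy y1; pose r k : R := 3^-1 ^+ k.
have r0 k : 0 <= r k by rewrite exprn_ge0 // invr_ge0.
have ex kz : exists z', l2 A kz.2 ->
    [/\ l2 A z', l2norm (z' - kz.2) <= r kz.1 & r kz.1 <= nrm (inner (y kz.1) z')].
  have [hz|nz] := pselect (l2 A kz.2); last by exists 0.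
  by have [z' hz'] := hump (hy kz.1) hz (y1 kz.1) (r0 kz.1); exists z'.
have [h hh] := choice ex.
pose u := fix u n := if n is m.+1 then h (m, u m) else 0.
have hu n : l2 A (u n).
  by elim: n => [|n IH] /=; [exact: l2_0 | case: (hh (n, u n) IH)].
have t0 : 0 <= 3^-1 :> R by rewrite invr_ge0.
have t1 : 3^-1 < 1 :> R by rewrite invf_lt1 // ltr1n.
have step n : l2norm (u n.+1 - u n) <= geom_major 1 3^-1 n.+1 - geom_major 1 3^-1 n.
  by rewrite geom_majorB // mul1r; case: (hh (n, u n) (hu n)).
have [z [hz zu]] := l2_complete hu (geom_major_cvg 1 t0 t1) step.
exists z => // k; have [_ _ /= hk] := hh (k, u k) (hu k).
have : nrm (inner (y k) (z - u k.+1)) <= r k / 2.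
  apply: le_trans (inner_le (hy k) (l2B hz (hu _))) _; rewrite y1 mul1r.
  apply: le_trans (zu _) _; rewrite /geom_major sub0r opprK mul1r exprS.
  by rewrite le_eqVlt; apply/orP; left; apply/eqP; rewrite /r; field.
have := ler_nrmB (inner (y k) z) (inner (y k) (z - u k.+1)).
have hzu := l2B hz (hu k.+1).
rewrite -innerBr // subKr; have -> : u k.+1 = h (k, u k) by [].
by move: hk; rewrite -/(r k); lra.
Qed.

(** An instance of the uniform boundedness principle.  If q were not bounded below
by the norm, there would be unit vectors y_k with q (y_k) < 4^-k, and for the
vector z of [hump_sequence] the inner products <y_k, z>, of norm at least
3^-k / 2, would not be O(q (y_k)). *)
Lemma bounded_below (q : (nat -> A) -> R) :
  (forall y, 0 <= q y) ->
  (forall (t : R) y, l2 A y -> 0 < t -> q (t%:C *: y) = t * q y) ->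
  (forall z, l2 A z -> exists C, forall y, l2 A y -> nrm (inner y z) <= C * q y) ->
  exists C, forall y, l2 A y -> l2norm y <= C * q y.
Proof.
move=> q0 qZ dom; apply: contrapT => /forallNP no.
have ex k : exists y, [/\ l2 A y, l2norm y = 1 & 4 ^+ k * q y < 1].
  have /existsNP [y /not_implyP [hy /negP]] := no (4 ^+ k).
  rewrite -ltNge => lty.
  have [y0|y0] := eqVneq (l2norm y) 0; last first.
    have n0 : 0 < (l2norm y)^-1 by rewrite invr_gt0 lt_def y0 l2norm_ge0.
    exists ((l2norm y)^-1%:C *: y); split; first exact: l2Z.
      rewrite l2normZ // normc_def /= expr0n addr0 sqrtr_sqr gtr0_norm //.
      by rewrite mulVf.
    by rewrite qZ // mulrCA mulrC ltr_pdivrMr ?mul1r // lt_def y0 l2norm_ge0.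
  by move: lty; rewrite y0 ltNge mulr_ge0.
have [y hy] := choice ex.
have l2y k : l2 A (y k) by case: (hy k).
have y1 k : l2norm (y k) = 1 by case: (hy k).
have [z hz zy] := hump_sequence l2y y1.
have [C hC] := dom z hz.
have le k : 2^-1 <= `|C| * (3 / 4) ^+ k.
  have [hyk yk1 qk] := hy k.
  have zC : 3^-1 ^+ k / 2 <= `|C| * q (y k).
    apply: le_trans (zy k) _; apply: le_trans (hC _ hyk) _.
    by rewrite ler_wpM2r ?ler_norm.
  have e3 : 3^-1 ^+ k * 3 ^+ k = 1 :> R by rewrite -exprMn mulVf ?expr1n.
  have -> : 2^-1 = 3 ^+ k * (3^-1 ^+ k / 2) :> R.
    by rewrite mulrA [_ * 3^-1 ^+ k]mulrC e3 mul1r.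
  apply: le_trans (ler_wpM2l _ zC) _; first by rewrite exprn_ge0.
  rewrite mulrCA ler_wpM2l // expr_div_n ler_pdivlMr ?exprn_gt0 //.
  by rewrite -mulrA ler_piMr ?exprn_ge0 // mulrC ltW.
have c0 : (fun k => `|C| * (3 / 4) ^+ k) @ \oo --> (0 : R).
  rewrite -(mulr0 `|C|); apply: cvgM; first exact: cvg_cst.
  by apply: cvg_expr; rewrite ger0_norm; lra.
have : (2^-1 : R) <= lim ((fun k => `|C| * (3 / 4) ^+ k) @ \oo).
  by apply: limr_ge; [exact: cvgP c0 | near=> k].
by rewrite (cvg_lim _ c0) //; lra.
Unshelve. all: by end_near. Qed.

(** The norm estimates hold for all y a, hence by [pos_le_of_nrm] they are
inequalities <y, y> <= C <y, S y> and <S y, S y> <= m <y, S y> in A.  With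
t = 1 / m they give <W y, W y> <= (1 - t / C) <y, y> for W = 1 - t S.  Thus W is
a contraction, and t S = 1 - W is invertible. *)
Lemma self_adjoint_inverse S (C m : R) : blin S ->
  (forall x y, l2 A x -> l2 A y -> inner (S x) y = inner x (S y)) ->
  (forall y, l2 A y -> pos (inner y (S y))) ->
  (forall y, l2 A y -> l2norm y ^+ 2 <= C * nrm (inner y (S y))) ->
  (forall y, l2 A y -> l2norm (S y) ^+ 2 <= m * nrm (inner y (S y))) ->
  exists V, adjointable V /\ forall y, l2 A y -> S (V y) = y.
Proof.
move=> hS SS pS lowS upS.
(* Increasing C and m keeps the hypotheses and makes 1 - t / C nonnegative. *)
wlog [C0 m1] : C m lowS upS / 0 < m /\ m^-1 <= C.
  have C1 := ler_norm C; have m1 := ler_norm m; have m0 := normr_ge0 m.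
  move=> /(_ (Num.max C (`|m| + 1)^-1) (`|m| + 1)); apply.
  - move=> y hy; apply: le_trans (lowS y hy) _.
    by rewrite ler_wpM2r ?nrm_ge0 // le_max lexx.
  - move=> y hy; apply: le_trans (upS y hy) _.
    by rewrite ler_wpM2r ?nrm_ge0 //; lra.
  - by split; [lra | rewrite le_max lexx orbT].
pose t := m^-1.
have t0 : 0 < t by rewrite invr_gt0.
have Cgt0 : 0 < C by exact: lt_le_trans t0 m1.
pose W y := y - t%:C *: S y.
have hW : blin W.
  exact: blin_add blin_id (blin_opp (blin_scale t hS)).
have tC : 0 <= 1 - t / C < 1.
  by rewrite subr_ge0 ler_pdivrMr // mul1r m1 /= ltrBlDr ltrDl divr_gt0.
case/andP: tC => q0 q1.
have Wq : bounded_by (l2 A) W (Num.sqrt (1 - t / C)).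
  move=> y hy; have hSy := blin_l2 hS hy; have hWy := blin_l2 hW hy.
  rewrite -(@ler_pXn2r _ 2) ?nnegrE ?mulr_ge0 ?sqrtr_ge0 ?l2norm_ge0 //.
  rewrite exprMn !l2norm_sqr sqr_sqrtr //.
  have low : pos (C%:C *: inner y (S y) - inner y y).
    apply: pos_le_of_nrm => [|||a]; [exact: inner_pos | exact: pS | exact: ltW |].
    have hya := l2r (a := a) hy.
    have := lowS _ hya; rewrite l2norm_sqr (blinr _ hS) // !innerr // !innerl //.
  have up : pos (m%:C *: inner y (S y) - inner (S y) (S y)).
    apply: pos_le_of_nrm => [|||a]; [exact: inner_pos | exact: pS | exact: ltW |].
    have hya := l2r (a := a) hy; have hSya := l2r (a := a) hSy.
    have := upS _ hya; rewrite l2norm_sqr (blinr _ hS) // !innerr // !innerl //.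
  rewrite -[X in X * nrm _](ger0_norm q0) -nrmZr.
  apply: pos_le_nrm; first exact: inner_pos.
  have -> : (1 - t / C)%:C *: inner y y - inner (W y) (W y) =
    (t / C)%:C *: (C%:C *: inner y (S y) - inner y y)
    + (t ^+ 2)%:C *: (m%:C *: inner y (S y) - inner (S y) (S y)).
    have htS : l2 A (t%:C *: S y) by exact: l2Z.
    have e1 : inner y (t%:C *: S y) = t%:C *: inner y (S y).
      by rewrite -rscaleZ1 innerr // cmulZr cmul1r.
    have e2 : inner (t%:C *: S y) y = t%:C *: inner y (S y).
      by rewrite -rscaleZ1 innerl // starZr star1 cmulZl cmul1l SS.
    have e3 : inner (t%:C *: S y) (t%:C *: S y) = (t ^+ 2)%:C *: inner (S y) (S y).
      rewrite -rscaleZ1 innerl ?innerr //; last by rewrite rscaleZ1.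
      by rewrite starZr star1 cmulZl cmul1l cmulZr cmul1r scalerA -rmorphM.
    rewrite {1}/W (innerBl hy htS hWy) /W (innerBr hy hy htS) (innerBr htS hy htS).
    rewrite e1 e2 e3 !scalerBr !scalerA -!rmorphM /= divfK ?gt_eqF //.
    have -> : t ^+ 2 * m = t by rewrite /t; field; rewrite gt_eqF.
    rewrite rmorphB rmorph1 scalerBl scale1r !opprB.
    rewrite addrCA addrC; congr (_ + _).
    by rewrite addrC addrA subrK.
  by apply: posD; apply: posZ => //; rewrite ?sqr_ge0 // divr_ge0 // ltW.
have [|N [hN eN]] := @neumann _ _ W _ hW (sqrtr_ge0 _) _ Wq.
  by rewrite -[X in _ < X]sqrtr1 ltr_sqrt.
pose V y := t%:C *: N y.
have hV : blin V by exact: blin_scale.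
have SV y : l2 A y -> S (V y) = y.
  move=> hy; rewrite /V (blinZ _ hS); last exact: blin_l2.
  by rewrite -[RHS](eN y hy) /W subKr.
exists V; split=> //; split=> //; exists V; split=> [y hy|x y hx hy].
  exact: blin_l2.
have hVx := blin_l2 hV hx; have hVy := blin_l2 hV hy.
by rewrite -{1}(SV y hy) -SS // SV.
Qed.

End Invert.

(** * From a decomposition to a right inverse modulo compact operators *)

Section Regularize.
Context {R : realType} {A : cstarAlgType R}.
Implicit Types (a b : A) (x y z : nat -> A) (e c t : R).
Implicit Types (S T V W D G : (nat -> A) -> nat -> A).

Lemma rank_one_blin x y : l2 A x -> l2 A y -> blin (rank_one x y).
Proof.
move=> hx hy; split=> [z hz|z w hz hw|z a hz|].
- exact: l2r.
- by rewrite /rank_one innerDr // rscaleDr.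
- by rewrite /rank_one innerr // rscaleM.
- exists (l2norm x * l2norm y) => z hz; apply: le_trans (l2normr _ hx) _.
  by rewrite -mulrA ler_wpM2l ?l2norm_ge0 ?inner_le.
Qed.

Lemma blin_sum n (T : 'I_n -> (nat -> A) -> nat -> A) :
  (forall k, blin (T k)) -> blin (fun x => \sum_(k < n) T k x).
Proof.
move=> hT; have exc k : exists c, bounded_by (l2 A) (T k) c.
  by have [c _ hc] := blin_bound (hT k); exists c.
have [c hc] := choice exc.
split=> [x hx|x y hx hy|x a hx|].
- by apply: l2_sum => k _; exact: blin_l2.
- by rewrite -big_split; apply: eq_bigr => k _; rewrite (blinD (hT k)).
- have -> : rscale (\sum_(k < n) T k x) a = \sum_(k < n) rscale (T k x) a.
    apply: (big_morph (fun x => rscale x a)) => [y z|]; first exact: rscaleDl.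
    by apply/funext => i; rewrite /rscale cmul0l.
  by apply: eq_bigr => k _; rewrite (blinr _ (hT k)).
- exists (\sum_(k < n) c k) => x hx.
  apply: le_trans (l2norm_sum _ _) _; first by move=> k; exact: blin_l2.
  by rewrite mulr_suml; apply: ler_sum => k _; exact: hc.
Qed.

(** The hypothesis says that T (x, a) = D x + sum_k g_k a_k is onto, and
S = D D^* + sum_k g_k <g_k, .> is T T^*.  Surjectivity makes T^* bounded below
([bounded_below]), so S has an inverse V, and D (D^* V) = 1 - sum_k g_k <V g_k, .>
is a finite-rank perturbation of the identity. *)
Lemma regularizer_of_spanning D (n : nat) (g : 'I_n -> nat -> A) :
  adjointable D -> (forall k, l2 A (g k)) ->
  (forall z, l2 A z -> exists x (a : 'I_n -> A),
      l2 A x /\ z = D x + \sum_(k < n) rscale (g k) (a k)) ->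
  exists F K, [/\ adjointable F, compact_operator K &
                  forall x, l2 A x -> D (F x) = x + K x].
Proof.
move=> hD hg surj; have [hDl _] := hD.
have [D' [hD' DD']] := adjointable_adjoint hD; have [hDl' _] := hD'.
pose G x := \sum_(k < n) rank_one (g k) (g k) x.
have hG : blin G by apply: blin_sum => k; exact: rank_one_blin.
pose S x := D (D' x) + G x.
have hS : blin S by exact: (blin_add (blin_comp hDl hDl') hG).
have innG x y : l2 A x -> l2 A y ->
    inner x (G y) = \sum_(k < n) star (inner (g k) x) ** inner (g k) y.
  move=> hx hy; rewrite inner_sumr // => [|k]; last exact: l2r.
  by apply: eq_bigr => k _; rewrite innerr // inner_star.
have lD x : l2 A x -> l2 A (D x) by exact: (blin_l2 hDl).
have lD' x : l2 A x -> l2 A (D' x) by exact: (blin_l2 hDl').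
have lS x : l2 A x -> l2 A (S x) by exact: (blin_l2 hS).
have lG x : l2 A x -> l2 A (G x) by exact: (blin_l2 hG).
have lr k a : l2 A (rscale (g k) a) by apply: l2r; exact: hg.
have innD x y : l2 A x -> l2 A y -> inner x (D y) = inner (D' x) y.
  move=> hx hy; rewrite -(inner_star (lD _ hy) hx) DD' //.
  by rewrite inner_star //; exact: lD'.
have innS x y : l2 A x -> l2 A y -> inner x (S y) =
    inner (D' x) (D' y) + \sum_(k < n) star (inner (g k) x) ** inner (g k) y.
  move=> hx hy; have h1 := lD' _ hy.
  by rewrite (innerDr hx (lD _ h1) (lG _ hy)) innD // innG.
have SS x y : l2 A x -> l2 A y -> inner (S x) y = inner x (S y).
  move=> hx hy; rewrite -(inner_star hy (lS _ hx)) !innS //.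
  rewrite starD star_sum (inner_star (lD' _ hy) (lD' _ hx)).
  by congr (_ + _); apply: eq_bigr => k _; rewrite starM starK.
have pk y k : pos (star (inner (g k) y) ** inner (g k) y) by exact: pos_starl.
have pG y : pos (\sum_(k < n) star (inner (g k) y) ** inner (g k) y).
  by apply: pos_sum => k _; exact: pk.
have pD y : l2 A y -> pos (inner (D' y) (D' y)).
  by move=> hy; apply: inner_pos; exact: lD'.
have pS y : l2 A y -> pos (inner y (S y)).
  by move=> hy; rewrite innS //; apply: posD => //; exact: pD.
(* q y is the norm of T^* y; it dominates both components of T^* y. *)
pose q y := Num.sqrt (nrm (inner y (S y))).
have q0 y : 0 <= q y by exact: sqrtr_ge0.
have q2 y : q y ^+ 2 = nrm (inner y (S y)) by rewrite sqr_sqrtr // nrm_ge0.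
have sqr_le (u v : R) : 0 <= u -> 0 <= v -> u ^+ 2 <= v ^+ 2 -> u <= v.
  by move=> u0 v0; rewrite ler_pXn2r.
have leD y : l2 A y -> l2norm (D' y) <= q y.
  move=> hy; apply: sqr_le (l2norm_ge0 _) (q0 _) _; rewrite l2norm_sqr (q2 y).
  apply: pos_le_nrm; first exact: pD.
  by rewrite innS // addrC addKr.
have leg y k : l2 A y -> nrm (inner (g k) y) <= q y.
  move=> hy; apply: sqr_le (nrm_ge0 _) (q0 _) _; rewrite -nrm_starl (q2 y).
  apply: pos_le_nrm => //; rewrite innS // (bigD1 k) //=.
  rewrite addrCA [X in pos (X - _)]addrC addrK; apply: posD; first exact: pD.
  by apply: pos_sum => j _; exact: pk.
have [C lowS] : exists C, forall y, l2 A y -> l2norm y <= C * q y.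
  apply: bounded_below => // [t y hy t0|z hz].
    have hSy := lS _ hy; rewrite /q (blinZ _ hS) // -!rscaleZ1.
    rewrite (innerl _ hy (l2r hSy)) (innerr _ hy hSy).
    rewrite starZr star1 cmulZl cmul1l cmulZr cmul1r scalerA -rmorphM nrmZr -expr2.
    by rewrite sqrtrM ?normr_ge0 // ger0_norm ?sqr_ge0 // sqrtr_sqr gtr0_norm.
  have [x [a [hx ->]]] := surj z hz; exists (l2norm x + \sum_(k < n) nrm (a k)) => y hy.
  rewrite (innerDr hy (lD _ hx)); last by apply: l2_sum => k _; exact: lr.
  rewrite mulrDl; apply: le_trans (ler_nrmD _ _) _; apply: lerD.
    rewrite innD //; apply: le_trans (inner_le (lD' _ hy) hx) _.
    by rewrite mulrC ler_wpM2l ?l2norm_ge0 ?leD.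
  rewrite inner_sumr // mulr_suml.
  apply: le_trans (ler_nrm_sum _ _) _; apply: ler_sum => k _.
  rewrite innerr // mulrC; apply: le_trans (nrmM _ _) _.
  by rewrite ler_wpM2r ?nrm_ge0 // -inner_star // nrm_star leg.
have [c c0 hc] := blin_bound hDl.
have upS y : l2 A y -> l2norm (S y) <= (c + \sum_(k < n) l2norm (g k)) * q y.
  move=> hy; apply: le_trans (l2normD (lD _ (lD' _ hy)) (lG _ hy)) _.
  rewrite mulrDl; apply: lerD.
    by apply: le_trans (hc _ (lD' _ hy)) _; rewrite ler_wpM2l ?leD.
  apply: le_trans (l2norm_sum _ _) _ => [k|]; first exact: lr.
  rewrite mulr_suml; apply: ler_sum => k _; apply: le_trans (l2normr _ (hg k)) _.
  by rewrite ler_wpM2l ?l2norm_ge0 ?leg.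
have sqle (u v w : R) : 0 <= u -> u <= v * w -> u ^+ 2 <= v ^+ 2 * w ^+ 2.
  by move=> u0 uvw; rewrite -exprMn ler_pXn2r // nnegrE (le_trans u0 uvw).
have lowS2 y : l2 A y -> l2norm y ^+ 2 <= C ^+ 2 * nrm (inner y (S y)).
  by move=> hy; rewrite -(q2 y); apply: sqle; rewrite ?l2norm_ge0 ?lowS.
have upS2 y : l2 A y ->
    l2norm (S y) ^+ 2 <= (c + \sum_(k < n) l2norm (g k)) ^+ 2 * nrm (inner y (S y)).
  by move=> hy; rewrite -(q2 y); apply: sqle; rewrite ?l2norm_ge0 ?upS.
have [V [hV SV]] := self_adjoint_inverse hS SS pS lowS2 upS2.
have [hVl _] := hV.
have Vsym x y : l2 A x -> l2 A y -> inner (V x) y = inner x (V y).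
  move=> hx hy; have hVx := blin_l2 hVl hx; have hVy := blin_l2 hVl hy.
  by rewrite -{1}(SV y hy) -SS // SV.
(* Taking K to be D F - 1 makes it adjointable at once; that it has finite rank
   is left for the approximation. *)
exists (D' \o V), (fun x => D (D' (V x)) - x).
have hDDV : adjointable (D \o (D' \o V)).
  exact: adjointable_comp hD (adjointable_comp hD' hV).
split; [exact: adjointable_comp hD' hV | | by move=> x _; rewrite addrC subrK].
split; first exact: (adjointable_subid hDDV).
move=> e e0; exists n, (fun=> -1), g, (fun k => V (g k)); split.
  by move=> k; split=> //; exact: (blin_l2 hVl).
move=> z hz; have hVz := blin_l2 hVl hz.
have -> : D (D' (V z)) - z - \sum_(k < n) -1 *: rank_one (g k) (V (g k)) z = 0.
  have -> : \sum_(k < n) -1 *: rank_one (g k) (V (g k)) z = - G (V z).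
    rewrite -scaler_sumr scaleN1r; congr (- _).
    by apply: eq_bigr => k _; rewrite /rank_one Vsym.
  by rewrite -{2}(SV z hz) /S opprK opprD addrA subrr add0r addNr.
by rewrite l2norm0 mulr_ge0 ?l2norm_ge0 ?ltW.
Qed.

(** As D(M1) = M2, the generators of N2 together with the range of D span l2.  This
avoids the projection onto M2 along N2, which need not be adjointable. *)
Theorem fredholm_regularizes D : lower_semi_fredholm D ->
  exists F K, [/\ adjointable F, compact_operator K &
                  forall x, l2 A x -> D (F x) = x + K x].
Proof.
case=> hD [M1 [N1 [M2 [N2 [[[[M1l _ _ _] _] _ _ _] [_ cN2 dec _] _ iso fg]]]]].
have [n [g eN2]] := fg; have [[N2l _ _ _] _] := cN2.
have [_ [S [[SM _ _ _] _ DS]]] := iso.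
have hg k : l2 A (g k).
  apply: N2l; rewrite eN2; exists (fun j => if j == k then cone else 0).
  rewrite (bigD1 k) //= eqxx big1 ?addr0 => [|j /negPf ->].
    by apply/funext => i; rewrite /rscale cmul1r.
  by apply/funext => i; rewrite /rscale cmul0r.
apply: (regularizer_of_spanning hD hg) => z hz.
have [m [v [hm]]] := dec z hz; rewrite eN2 => -[a ->] ->.
by exists (S m), a; split; [exact/M1l/SM | rewrite DS].
Qed.

End Regularize.

(** * From a right inverse modulo compact operators to a decomposition *)

Section Decompose.
Context {R : realType} {A : cstarAlgType R}.
Implicit Types (a b : A) (x y z : nat -> A) (e c t : R).
Implicit Types (S T V W D E F G K : (nat -> A) -> nat -> A).

(** Kernels of bounded operators are closed submodules; every summand below,
ranges of idempotents included, is presented as a kernel. *)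
Definition ker T : set (nat -> A) := [set x | l2 A x /\ T x = 0].

Lemma ker_closed T : blin T -> closed_submodule (ker T).
Proof.
move=> hT; split.
  split=> [x []//||x y [hx Tx] [hy Ty]|x a [hx Tx]].
  - by split; [exact: l2_0 | exact: blin0].
  - by split; [exact: l2D | rewrite (blinD hT) // Tx Ty addr0].
  - split; [exact: l2r | rewrite (blinr _ hT) // Tx].
    by apply/funext => i; rewrite /rscale cmul0l.
move=> x hx cl; split=> //; have [c c0 hc] := blin_bound hT.
apply: l2norm_eq0; first exact: (blin_l2 hT).
apply/ler_addgt0Pr => e e0; rewrite add0r.
have c1 : 0 < c + 1 by lra.
have [y [hy Ty]] := cl _ (divr_gt0 e0 c1); rewrite ltr_pdivlMr // => lt.
have := hc _ (l2B hx hy); rewrite (blinB hT) // Ty subr0 => h.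
by have := l2norm_ge0 (x - y); lra.
Qed.

Lemma idempotent_direct_sum E : blin E -> (forall x, l2 A x -> E (E x) = E x) ->
  l2_direct_sum (ker (fun x => x - E x)) (ker E).
Proof.
move=> hE EE; split.
- exact/ker_closed/(blin_add blin_id (blin_opp hE)).
- exact: ker_closed.
- move=> x hx; have hEx := blin_l2 hE hx; exists (E x), (x - E x); split.
  + by split; rewrite // EE // subrr.
  + by split; [exact: l2B | rewrite (blinB hE) // EE // subrr].
  + by rewrite subrKC.
- apply/seteqP; split=> [x [[_ e1] [_ e2]]|x ->] /=.
    by move: e1; rewrite e2 subr0.
  by split; split; rewrite ?(blin0 hE) ?subr0 //; exact: l2_0.
Qed.

(** G D G = G makes G D and D G idempotent, and D maps the range of G D onto the
range of D G with inverse G, and ker (G D) into ker (D G). *)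
Lemma generalized_inverse_fredholm D G : adjointable D -> blin G ->
  (forall x, l2 A x -> G (D (G x)) = G x) ->
  finitely_generated (ker (D \o G)) -> lower_semi_fredholm D.
Proof.
move=> hD hG GDG fg; have [hDl _] := hD; split=> //.
have lD x : l2 A x -> l2 A (D x) by exact: (blin_l2 hDl).
have lG x : l2 A x -> l2 A (G x) by exact: (blin_l2 hG).
exists (ker (fun x => x - (G \o D) x)), (ker (G \o D)),
       (ker (fun x => x - (D \o G) x)), (ker (D \o G)); split=> //.
- apply: idempotent_direct_sum; first exact: blin_comp.
  by move=> x hx /=; rewrite GDG //; exact: lD.
- apply: idempotent_direct_sum; first exact: blin_comp.
  by move=> x hx /=; rewrite GDG.
- by move=> x [hx /= e]; split; [exact: lD | rewrite /= e (blin0 hDl)].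
have fixP T x : x - T x = 0 -> T x = x by move=> /eqP; rewrite subr_eq0 => /eqP.
split.
  have [_ hDD hDr [c hc]] := hDl.
  split=> [x [hx /fixP /= e]|x y [hx _] [hy _]|x a [hx _]|].
  - by split; [exact: lD | rewrite /= e subrr].
  - exact: hDD.
  - exact: hDr.
  - by exists c => x [hx _]; exact: hc.
exists G; split=> [|x [_ /fixP]//|y [_ /fixP]//].
have [_ hGD hGr [c hc]] := hG.
split=> [x [hx /fixP /= e]|x y [hx _] [hy _]|x a [hx _]|].
- by split; [exact: lG | rewrite /= GDG ?subrr].
- exact: hGD.
- exact: hGr.
- by exists c => x [hx _]; exact: hc.
Qed.

Definition tail (n : nat) x : nat -> A := fun i => if (i < n)%N then 0 else x i.

Lemma wip_tail n M x : wip 0 M (tail n x) (tail n x) = wip n M x x.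
Proof.
have z i : (i < n)%N -> star (tail n x i) ** tail n x i = 0.
  by rewrite /tail => ->; rewrite cmul0r.
have [nM|Mn] := leqP n M.
  rewrite (wip_split _ _ nM) {1}/wip big_nat big1 => [|i /andP[_]]; last exact: z.
  rewrite add0r; apply: eq_big_nat => i /andP[ni _].
  by rewrite /tail ltnNge ni.
rewrite {2}/wip big_geq ?(ltnW Mn) // /wip big_nat big1 // => i /andP[_ iM].
by apply: z; exact: ltn_trans iM Mn.
Qed.

Lemma wnrm_tail n M x : wnrm 0 M (tail n x) = wnrm n M x.
Proof. by rewrite /wnrm wip_tail. Qed.

Lemma wnrm_tail_le n N M x : wnrm N M (tail n x) <= wnrm N M x.
Proof.
rewrite wnrm_leP ?wnrm_ge0 // wnrm_sqr; apply: pos_le_nrm; first exact: wip_pos.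
rewrite /wip -sumrB; apply: pos_sum => i _; rewrite /tail.
by case: ifP => _; rewrite ?subrr ?cmul0r ?subr0; [exact: pos_starl | exact: pos0].
Qed.

Lemma tailD n x y : tail n (x + y) = tail n x + tail n y.
Proof.
apply/funext => i; have pt (f g : nat -> A) : (f + g) i = f i + g i by [].
by rewrite pt /tail; case: ifP => // _; rewrite addr0.
Qed.

Lemma l2_tail n x : l2 A x -> l2 A (tail n x).
Proof.
move=> /l2P h; apply/l2P => e e0; have [N hN] := h e e0; exists N => M.
exact: le_trans (wnrm_tail_le _ _ _ _) (hN M).
Qed.

Lemma tail_le n x : l2 A x -> l2norm (tail n x) <= l2norm x.
Proof.
move=> hx; apply: l2norm_le => [||M]; [exact: l2_tail | exact: l2norm_ge0 |].
by apply: le_trans (wnrm_tail_le _ _ _ _) _; exact: wnrm_le_l2norm.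
Qed.

Lemma tail_blin n : blin (tail n).
Proof.
split=> [x|x y _ _|x a _|]; [exact: l2_tail | exact: tailD | |].
- by apply/funext => i; rewrite /tail /rscale; case: ifP; rewrite ?cmul0l.
- by exists 1 => x hx; rewrite mul1r tail_le.
Qed.

Lemma tailK n x : tail n (tail n x) = tail n x.
Proof. by apply/funext => i; rewrite /tail; case: (i < n)%N. Qed.

Lemma tail_cvg0 x : l2 A x -> (fun n => l2norm (tail n x)) @ \oo --> (0 : R).
Proof.
move=> hx; apply/cvgr0Pnorm_le => e e0.
have /l2P/(_ e e0) [N hN] := hx; exists N => // n /= Nn.
rewrite ger0_norm ?l2norm_ge0 //; apply: l2norm_le => [||M].
- exact: l2_tail.
- exact: ltW.
- by rewrite wnrm_tail; apply: le_trans (wnrm_mono _ _ Nn) _.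
Qed.

Lemma ker_tail_fg n : finitely_generated (ker (tail n)).
Proof.
exists n, (fun k i => if i == k :> nat then cone else 0).
pose d (k : 'I_n) i : A := if i == k :> nat then cone else 0.
have sumE (a : 'I_n -> A) i : (\sum_(k < n) rscale (d k) (a k)) i =
    \sum_(k < n | i == k :> nat) a k.
  rewrite fct_sumE [RHS]big_mkcond; apply: eq_bigr => k _.
  by rewrite /rscale /d; case: ifP => _; rewrite ?cmul1l ?cmul0l.
apply/seteqP; split=> [x [hx tx]|x [a ->]] /=.
  exists (fun k => x k); apply/funext => i; rewrite sumE.
  have [ni|i_n] := leqP n i.
    have := congr1 (@^~ i) tx; rewrite /tail ltnNge ni /= => ->.
    by rewrite big1 // => k /eqP ik; move: (ltn_ord k); rewrite -ik ltnNge ni.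
  by rewrite (big_pred1 (Ordinal i_n)).
split.
  apply: l2_sum => k _; apply: l2r; apply/l2P => e e0; exists k.+1 => M.
  rewrite /wnrm /wip big_nat big1 ?nrm0 ?sqrtr0 ?ltW // => i /andP[ki _].
  by rewrite gtn_eqF // cmul0r.
apply/funext => i; rewrite /tail; case: ifP => // /negbT; rewrite -leqNgt => ni.
rewrite sumE big1 // => k /eqP ik; move: (ltn_ord k).
by rewrite -ik ltnNge ni.
Qed.

(** For a rank-one operator x <y, .> the tails of x tend to 0; a compact operator
is a finite sum of these up to an error of norm 1/4. *)
Lemma compact_tail K : compact_operator K ->
  exists n, bounded_by (l2 A) (tail n \o K) 2^-1.
Proof.
case=> [[hK _]] /(_ 4^-1) [|m [c [x [y [hxy hc]]]]]; first by rewrite invr_gt0.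
pose B k := complex.Re `|c k| * l2norm (y k).
have B0 k : 0 <= complex.Re `|c k| by rewrite -ler0c RRe_real ?normr_real.
have cv (r : seq 'I_m) :
    (fun n => \sum_(k <- r) l2norm (tail n (x k)) * B k) @ \oo --> (0 : R).
  elim: r => [|k r IH].
    by under eq_fun do rewrite big_nil; exact: cvg_cst.
  under eq_fun do rewrite big_cons.
  have cvk : (fun n => l2norm (tail n (x k)) * B k) @ \oo --> 0 * B k.
    by apply: cvgM; [apply: tail_cvg0; case: (hxy k) | exact: cvg_cst].
  by have := cvgD cvk IH; rewrite mul0r addr0; apply.
have /cvgr0Pnorm_le/(_ 4^-1) := cv (index_enum 'I_m); case; first by rewrite invr_gt0.
move=> n _ /(_ n (leqnn n)) /=; rewrite ger0_norm; last first.
  by apply: sumr_ge0 => k _; rewrite !mulr_ge0 ?l2norm_ge0.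
move=> hn; exists n => z hz /=; have hQ := tail_blin n.
have hKz := blin_l2 hK hz.
have hr k : l2 A (c k *: rank_one (x k) (y k) z).
  by apply: l2Z; apply: l2r; case: (hxy k).
have hs : l2 A (\sum_(k < m) c k *: rank_one (x k) (y k) z) by exact: l2_sum.
rewrite -(subrK (\sum_(k < m) c k *: rank_one (x k) (y k) z) (K z)).
have hd := l2B hKz hs.
rewrite (blinD hQ hd hs); apply: le_trans (l2normD _ _) _; try exact: (blin_l2 hQ).
have -> : 2^-1 = 4^-1 + 4^-1 :> R by field.
rewrite mulrDl; apply: lerD; first by apply: le_trans (tail_le _ hd) _; exact: hc.
have -> : tail n (\sum_(k < m) c k *: rank_one (x k) (y k) z)
    = \sum_(k < m) tail n (c k *: rank_one (x k) (y k) z).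
  apply: (big_morph (tail n)) => [u v|]; [exact: tailD | exact: (blin0 hQ)].
apply: le_trans (l2norm_sum _ _) _ => [k|]; first exact: (blin_l2 hQ).
apply: le_trans (ler_wpM2r (l2norm_ge0 z) hn).
rewrite mulr_suml; apply: ler_sum => k _; have [hx hy] := hxy k.
have htx := blin_l2 hQ hx.
rewrite (blinZ _ hQ); last exact: l2r.
rewrite l2normZ; last by apply: (blin_l2 hQ); exact: l2r.
rewrite /rank_one (blinr _ hQ) // /B mulrCA -!mulrA ler_wpM2l //.
apply: le_trans (l2normr _ htx) _; rewrite ler_wpM2l ?l2norm_ge0 //.
exact: inner_le.
Qed.

(** Let Q be the n-th tail, with |Q K| <= 1/2, and V = (1 + Q K)^-1.  As
Q V Q + Q K V Q = Q, the operator G = F V Q satisfies Q D G = Q, hence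
G D G = G, and the kernel of D G is that of Q. *)
Theorem regularized_fredholm D F K : adjointable D -> adjointable F ->
  compact_operator K -> (forall x, l2 A x -> D (F x) = x + K x) ->
  lower_semi_fredholm D.
Proof.
move=> hD [hF _] cK DF; have [[hK _] _] := cK.
have [n hn] := compact_tail cK; have hQ := tail_blin n.
have hW : blin (fun x => - (tail n \o K) x) by exact: (blin_opp (blin_comp hQ hK)).
have Wn : bounded_by (l2 A) (fun x => - (tail n \o K) x) 2^-1.
  by move=> x hx; rewrite l2normN; exact: hn.
have [||V [hV VK]] := neumann hW _ _ Wn; [by lra | by lra |].
have lQ x : l2 A x -> l2 A (tail n x) by exact: (blin_l2 hQ).
have lK x : l2 A x -> l2 A (K x) by exact: (blin_l2 hK).
have lV x : l2 A x -> l2 A (V x) by exact: (blin_l2 hV).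
pose G := F \o (V \o tail n).
have hG : blin G by exact: (blin_comp hF (blin_comp hV hQ)).
have QDG x : l2 A x -> tail n (D (G x)) = tail n x.
  move=> hx; have hVQ := lV _ (lQ _ hx).
  rewrite /G /= DF // (blinD hQ hVQ (lK _ hVQ)).
  have := VK _ (lQ _ hx); rewrite opprK /= => e.
  (* Q is applied to the equation V Q x + Q K V Q x = Q x. *)
  rewrite -[RHS](tailK n) -[in RHS]e (blinD hQ hVQ) ?tailK //.
  exact/lQ/lK.
apply: (@generalized_inverse_fredholm D G) => //.
  by move=> x hx; rewrite {1}/G /= QDG.
suff -> : ker (D \o G) = ker (tail n) by exact: ker_tail_fg.
have [hDl _] := hD.
apply/seteqP; split=> [x [hx /= e]|x [hx e]]; split=> //=.
  by rewrite -QDG // e (blin0 hQ).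
by rewrite /G /= e (blin0 hV) (blin0 hF) (blin0 hDl).
Qed.

End Decompose.

Theorem theorem2p3 (R : realType) (A : cstarAlgType R)
    (D : (nat -> A) -> nat -> A) (hD : adjointable D) :
  lower_semi_fredholm D <->
  exists F K : (nat -> A) -> nat -> A,
    [/\ adjointable F, compact_operator K &
        forall x, l2 A x -> D (F x) = x + K x].
Proof.
split; first exact: fredholm_regularizes.
by case=> F [K [hF cK DF]]; exact: regularized_fredholm hD hF cK DF.
Qed.
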